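(* The cut elimination reduction $\rightarrow$ on proof nets is strongly normalizing. The normal forms are cut free proof nets.
   Context: Write ⅋ for par and $\odot$ for the cut connective. Proof graphs $\langle P\mid\Gamma\rangle$ consist of an MLL linking tree $P$ (generated by $\mathsf1\mid a\otimes a^\perp\mid a^\perp\otimes a\mid\bot\otimes L\mid L\otimes\bot\mid L⅋L$) and a sequent with cuts $\Gamma$ (cuts $A\odot A^\perp$ only at roots) sharing the same leaves, such that every switching (one child edge of each ⅋-node deleted; $\odot$ behaves as $\otimes$) is connected and acyclic. Proof nets are $\sim$-classes of proof graphs, where $\sim$ is generated by commutativity/associativity of ⅋ in the linking, commutativity of $\otimes$, $\bot_i\otimes(Q\otimes\bot_j)\sim(\bot_i\otimes Q)\otimes\bot_j$, and $Q⅋(R\otimes\bot_i)\sim(Q⅋R)\otimes\bot_i$ (side condition: no node of $Q$ connected to $\bot_i$ in any switching with the edge from $\bot_i$ to its parent also removed). Cut reduction on graphs: $\langle P\mid(A⅋B)\odot(B^\perp\otimes A^\perp),\Gamma\rangle\to\langle P\mid A\odot A^\perp,B\odot B^\perp,\Gamma\rangle$; $\langle P[(a_h^\perp\otimes a_i)⅋(a_j^\perp\otimes a_k)]\mid a_i\odot a_j^\perp,\Gamma\rangle\to\langle P[a_h^\perp\otimes a_k]\mid\Gamma\rangle$; $\langle P[(Q\otimes\bot_i)⅋\mathsf1_j]\mid\bot_i\odot\mathsf1_j,\Gamma\rangle\to\langle P[Q]\mid\Gamma\rangle$. On nets, $[P\mid\Gamma]\to[Q\mid\Delta]$ iff there are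 $\langle P'\mid\Gamma\rangle\sim\langle P\mid\Gamma\rangle$ and $\langle Q'\mid\Delta\rangle\sim\langle Q\mid\Delta\rangle$ with $\langle P'\mid\Gamma\rangle\to\langle Q'\mid\Delta\rangle$. *)

(* Defs.v *)
From Stdlib Require Import List Relations Permutation.
Import ListNotations.

Inductive lit : Type := Pos (a : nat) | Neg (a : nat) | One | Bot.

(** Formulas whose leaves carry an occurrence index i (a_i, a_i^⊥, 1_i, ⊥_i). *)
Inductive form : Type :=
| FLeaf (i : nat) (l : lit)
| FTens (A B : form)
| FPar  (A B : form).

Inductive entry : Type :=
| EForm (A : form)
| ECut  (A B : form).

Definition sequent := list entry.

(** MLL linking trees, following the grammar
    P ::= 1 | a ⊗ a^⊥ | a^⊥ ⊗ a | ⊥ ⊗ P | P ⊗ ⊥ | P ⅋ P. *)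
Inductive linking : Type :=
| LOne  (i : nat)
| LAxPN (a i j : nat)              (* a_i ⊗ a_j^⊥ *)
| LAxNP (a i j : nat)              (* a_i^⊥ ⊗ a_j *)
| LBotL (i : nat) (P : linking)
| LBotR (P : linking) (i : nat)
| LPar  (P Q : linking).

Definition pgraph := (linking * sequent)%type.

(** Duality: B is (the shape of) A^⊥, with (A⅋B)^⊥ = B^⊥ ⊗ A^⊥. *)
Definition dual_lit (l m : lit) : Prop :=
  match l, m with
  | Pos a, Neg b => a = b
  | Neg a, Pos b => a = b
  | One, Bot => True
  | Bot, One => True
  | _, _ => False
  end.

Fixpoint is_dual (A B : form) : Prop :=
  match A, B with
  | FLeaf _ l, FLeaf _ m => dual_lit l m
  | FTens A1 A2, FPar B1 B2 => is_dual A1 B2 /\ is_dual A2 B1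
  | FPar A1 A2, FTens B1 B2 => is_dual A1 B2 /\ is_dual A2 B1
  | _, _ => False
  end.

Fixpoint fleaves (A : form) : list (nat * lit) :=
  match A with
  | FLeaf i l => [(i, l)]
  | FTens A B | FPar A B => fleaves A ++ fleaves B
  end.

Definition eleaves (e : entry) : list (nat * lit) :=
  match e with
  | EForm A => fleaves A
  | ECut A B => fleaves A ++ fleaves B
  end.

Definition sleaves (G : sequent) : list (nat * lit) := flat_map eleaves G.

Fixpoint lleaves (P : linking) : list (nat * lit) :=
  match P with
  | LOne i => [(i, One)]
  | LAxPN a i j => [(i, Pos a); (j, Neg a)]
  | LAxNP a i j => [(i, Neg a); (j, Pos a)]
  | LBotL i Q => (i, Bot) :: lleaves Q
  | LBotR Q i => lleaves Q ++ [(i, Bot)]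
  | LPar Q R => lleaves Q ++ lleaves R
  end.

(** Vertices: shared leaves (by index), internal nodes of the linking
    (by address), internal nodes / cut nodes of the k-th sequent entry
    (by address; for a cut entry, [] is the ⊙ node, false/true its sides). *)
Inductive vertex : Type :=
| VL (i : nat)
| VP (p : list bool)
| VG (k : nat) (p : list bool).

(** Edges, from parent to child; a child edge of a ⅋-node [v] carries the
    tag [Some (v, side)]. *)
Record edge : Type := Edge { e_src : vertex; e_dst : vertex; e_tag : option (vertex * bool) }.

Definition fnode (k : nat) (p : list bool) (A : form) : vertex :=
  match A with FLeaf i _ => VL i | _ => VG k p end.

Fixpoint fedges (k : nat) (p : list bool) (A : form) : list edge :=
  match A with
  | FLeaf _ _ => []
  | FTens A1 A2 =>
      Edge (VG k p) (fnode k (p ++ [false]) A1) None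
      :: Edge (VG k p) (fnode k (p ++ [true]) A2) None
      :: fedges k (p ++ [false]) A1 ++ fedges k (p ++ [true]) A2
  | FPar A1 A2 =>
      Edge (VG k p) (fnode k (p ++ [false]) A1) (Some (VG k p, false))
      :: Edge (VG k p) (fnode k (p ++ [true]) A2) (Some (VG k p, true))
      :: fedges k (p ++ [false]) A1 ++ fedges k (p ++ [true]) A2
  end.

Fixpoint fverts (k : nat) (p : list bool) (A : form) : list vertex :=
  match A with
  | FLeaf i _ => [VL i]
  | FTens A1 A2 | FPar A1 A2 =>
      VG k p :: fverts k (p ++ [false]) A1 ++ fverts k (p ++ [true]) A2
  end.

(** The cut node ⊙ behaves as a ⊗ node. *)
Definition entry_edges (k : nat) (e : entry) : list edge :=
  match e with
  | EForm A => fedges k [] A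
  | ECut A B =>
      Edge (VG k []) (fnode k [false] A) None
      :: Edge (VG k []) (fnode k [true] B) None
      :: fedges k [false] A ++ fedges k [true] B
  end.

Definition entry_verts (k : nat) (e : entry) : list vertex :=
  match e with
  | EForm A => fverts k [] A
  | ECut A B => VG k [] :: fverts k [false] A ++ fverts k [true] B
  end.

Fixpoint seq_edges (k : nat) (G : sequent) : list edge :=
  match G with
  | [] => []
  | e :: G' => entry_edges k e ++ seq_edges (S k) G'
  end.

Fixpoint seq_verts (k : nat) (G : sequent) : list vertex :=
  match G with
  | [] => []
  | e :: G' => entry_verts k e ++ seq_verts (S k) G'
  end.

Definition lnode (p : list bool) (P : linking) : vertex :=
  match P with LOne i => VL i | _ => VP p end.

Fixpoint ledges (p : list bool) (P : linking) : list edge :=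
  match P with
  | LOne _ => []
  | LAxPN _ i j | LAxNP _ i j => [Edge (VP p) (VL i) None; Edge (VP p) (VL j) None]
  | LBotL i Q =>
      Edge (VP p) (VL i) None
      :: Edge (VP p) (lnode (p ++ [true]) Q) None
      :: ledges (p ++ [true]) Q
  | LBotR Q i =>
      Edge (VP p) (lnode (p ++ [false]) Q) None
      :: Edge (VP p) (VL i) None
      :: ledges (p ++ [false]) Q
  | LPar Q R =>
      Edge (VP p) (lnode (p ++ [false]) Q) (Some (VP p, false))
      :: Edge (VP p) (lnode (p ++ [true]) R) (Some (VP p, true))
      :: ledges (p ++ [false]) Q ++ ledges (p ++ [true]) R
  end.

Fixpoint lverts (p : list bool) (P : linking) : list vertex :=
  match P with
  | LOne i => [VL i]
  | LAxPN _ i j | LAxNP _ i j => [VP p; VL i; VL j]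
  | LBotL i Q => VP p :: VL i :: lverts (p ++ [true]) Q
  | LBotR Q i => VP p :: VL i :: lverts (p ++ [false]) Q
  | LPar Q R => VP p :: lverts (p ++ [false]) Q ++ lverts (p ++ [true]) R
  end.

Definition gedges (X : pgraph) : list edge := ledges [] (fst X) ++ seq_edges 0 (snd X).
Definition gverts (X : pgraph) : list vertex := lverts [] (fst X) ++ seq_verts 0 (snd X).

(** A switching chooses, for each ⅋-node, which child edge is kept
    (the other one is deleted). *)
Definition switching := vertex -> bool.

Definition kept (s : switching) (e : edge) : Prop :=
  match e_tag e with
  | None => True
  | Some (v, b) => s v = b
  end.

Definition adj (E : list edge) (keep : edge -> Prop) (u v : vertex) : Prop :=
  exists e, In e E /\ keep e /\ e_src e = u /\ e_dst e = v.

Definition connected_in (E : list edge) (keep : edge -> Prop) (u v : vertex) : Prop :=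
  clos_refl_sym_trans vertex (adj E keep) u v.

Fixpoint trail (E : list edge) (keep : edge -> Prop) (u v : vertex) (es : list nat) : Prop :=
  match es with
  | [] => u = v
  | k :: es' =>
      exists e, nth_error E k = Some e /\ keep e /\
        ((e_src e = u /\ trail E keep (e_dst e) v es') \/
         (e_dst e = u /\ trail E keep (e_src e) v es'))
  end.

Definition has_cycle (E : list edge) (keep : edge -> Prop) : Prop :=
  exists u es, es <> [] /\ NoDup es /\ trail E keep u u es.

Definition switching_correct (X : pgraph) : Prop :=
  forall s : switching,
    (forall u v, In u (gverts X) -> In v (gverts X) -> connected_in (gedges X) (kept s) u v)
    /\ ~ has_cycle (gedges X) (kept s).

Definition proof_graph (X : pgraph) : Prop :=
  Permutation (lleaves (fst X)) (sleaves (snd X))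
  /\ NoDup (map fst (lleaves (fst X)))
  /\ (forall A B, In (ECut A B) (snd X) -> is_dual A B)
  /\ switching_correct X.

Inductive lctx : Type :=
| Hole
| CParL (C : lctx) (R : linking)
| CParR (Q : linking) (C : lctx)
| CBotL (i : nat) (C : lctx)
| CBotR (C : lctx) (i : nat).

Fixpoint plug (C : lctx) (X : linking) : linking :=
  match C with
  | Hole => X
  | CParL C R => LPar (plug C X) R
  | CParR Q C => LPar Q (plug C X)
  | CBotL i C => LBotL i (plug C X)
  | CBotR C i => LBotR (plug C X) i
  end.

Fixpoint caddr (C : lctx) : list bool :=
  match C with
  | Hole => []
  | CParL C _ => false :: caddr C
  | CParR _ C => true :: caddr C
  | CBotL _ C => true :: caddr C
  | CBotR C _ => false :: caddr C
  end.

(** Side condition of  Q ⅋ (R ⊗ ⊥_i) ~ (Q ⅋ R) ⊗ ⊥_i  (checked in the graph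
    ⟨P[Q ⅋ (R ⊗ ⊥_i)] | Γ⟩): no node of Q is connected to ⊥_i in any
    switching in which the edge from ⊥_i to its parent is also removed. *)
Definition par_bot_side (C : lctx) (Q R : linking) (i : nat) (G : sequent) : Prop :=
  forall (s : switching) (v : vertex),
    In v (lverts (caddr C ++ [false]) Q) ->
    ~ connected_in (gedges (plug C (LPar Q (LBotR R i)), G))
        (fun e => kept s e /\ e <> Edge (VP (caddr C ++ [true])) (VL i) None)
        v (VL i).

(** Generating steps.  Besides the linking moves of the paper we include
    the identification of sequents up to the order of their entries and of
    cuts up to the symmetry A ⊙ B = B ⊙ A. *)
Inductive simstep : pgraph -> pgraph -> Prop :=
| ss_par_comm C Q R G :
    simstep (plug C (LPar Q R), G) (plug C (LPar R Q), G)
| ss_par_assoc C Q R S G :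
    simstep (plug C (LPar Q (LPar R S)), G) (plug C (LPar (LPar Q R) S), G)
| ss_ax_comm C a i j G :
    simstep (plug C (LAxPN a i j), G) (plug C (LAxNP a j i), G)
| ss_bot_comm C i Q G :
    simstep (plug C (LBotL i Q), G) (plug C (LBotR Q i), G)
| ss_bot_assoc C i Q j G :
    simstep (plug C (LBotL i (LBotR Q j)), G) (plug C (LBotR (LBotL i Q) j), G)
| ss_par_bot C Q R i G :
    par_bot_side C Q R i G ->
    simstep (plug C (LPar Q (LBotR R i)), G) (plug C (LBotR (LPar Q R) i), G)
| ss_seq_swap P G1 e1 e2 G2 :
    simstep (P, G1 ++ e1 :: e2 :: G2) (P, G1 ++ e2 :: e1 :: G2)
| ss_cut_swap P G1 A B G2 :
    simstep (P, G1 ++ ECut A B :: G2) (P, G1 ++ ECut B A :: G2).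

Definition sim : pgraph -> pgraph -> Prop :=
  clos_refl_sym_trans pgraph (fun X Y => proof_graph X /\ proof_graph Y /\ simstep X Y).

Inductive gred : pgraph -> pgraph -> Prop :=
| gr_mult P A B A' B' G :
    gred (P, ECut (FPar A B) (FTens B' A') :: G) (P, ECut A A' :: ECut B B' :: G)
| gr_ax C a h i j k G :
    gred (plug C (LPar (LAxNP a h i) (LAxNP a j k)), ECut (FLeaf i (Pos a)) (FLeaf j (Neg a)) :: G)
         (plug C (LAxNP a h k), G)
| gr_unit C Q i j G :
    gred (plug C (LPar (LBotR Q i) (LOne j)), ECut (FLeaf i Bot) (FLeaf j One) :: G)
         (plug C Q, G).

(** Reduction on proof nets (~-classes), expressed on representatives. *)
Definition netred (X Y : pgraph) : Prop :=
  proof_graph X /\ proof_graph Y /\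
  exists X' Y', sim X X' /\ sim Y Y' /\ gred X' Y'.

Definition cut_free (X : pgraph) : Prop :=
  forall e, In e (snd X) -> exists A, e = EForm A.

(* Main.v *)
(* Termination holds because every cut reduction shrinks the sequent, while ~
   only permutes it.

   For normal forms one has to show that every cut can be reduced.  A switching
   of a linking (or of a formula) is first contracted onto its leaves: it becomes
   a forest on leaf indices with one leaf r representing the root, and correctness
   says that the union of the two sides is always a spanning tree.  In this form
   the reduction rules and the moves of ~ are seen to preserve correctness.

   For a cut between two leaves i and j, let L1 and L2 be the links containing
   them.  If L1 and L2 overlapped, the cut would close a cycle, so they meet at a
   ⅋ node, and it remains to clear the two paths from L1 and L2 to this node.  A
   ⅋ on such a path is moved below by associativity.  A ⊥ below a ⅋ can always be
   moved up into the side premise: a path joining the ⊥ to the subtree it is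
   tensored with could be prolonged, by switching the ⅋s of this subtree, to a
   cycle.  If both paths carry nothing but ⊥s, a ⊥ can be moved down across the
   ⅋ node: both sides of the ⅋ are always connected through the cut, so again a
   connection of the ⊥ with the other side would give a cycle. *)
Require Import Defs.
From Stdlib Require Import List Relations Permutation Lia PeanoNat Bool.
Import ListNotations.

(** Both [sim] and [netred] ask every graph they relate to be a proof graph, so exhibiting a redex
    requires correctness of each intermediate graph and of the reduct. Correctness is stated on
    vertices named by addresses, and every move renames them; this is the reason for passing to
    leaves, whose names never change. There a move of ⊥ only changes one end of one edge, and a cut
    between leaves is a single edge. A linking has no general ⊗: below a link there are only ⅋s and
    ⊗s with a ⊥, so these two cases exhaust the paths to be cleared. Their order matters. A ⊥ may
    cross the common ⅋ downwards only if it is apart from the other side in all switchings. The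
    argument for this needs each cut leaf to be joined to the ⅋ node in all switchings, which fails
    while a ⅋ on one of the paths can be switched away from the link. Hence all ⅋s are cleared from
    both paths before any ⊥ is moved down, and each single step lowers the total length of the two
    paths. *)

(** * Connectivity, forests and spanning trees for lists of edges *)

Definition conn {V : Type} (E : list (V * V)) : V -> V -> Prop :=
  clos_refl_sym_trans V (fun u v => In (u, v) E).

Lemma conn_refl {V} (E : list (V * V)) u : conn E u u.
Proof. apply rst_refl. Qed.

Lemma conn_sym {V} (E : list (V * V)) u v : conn E u v -> conn E v u.
Proof. apply rst_sym. Qed.

Lemma conn_trans {V} (E : list (V * V)) u v w : conn E u v -> conn E v w -> conn E u w.
Proof. apply rst_trans. Qed.

Lemma conn_edge {V} (E : list (V * V)) u v : In (u, v) E -> conn E u v.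
Proof. intros H. now apply rst_step. Qed.

#[local] Hint Resolve conn_refl conn_edge : core.

Lemma conn_map {V W} (f : V -> W) E E' x y :
  (forall u v, In (u, v) E -> conn E' (f u) (f v)) ->
  conn E x y -> conn E' (f x) (f y).
Proof.
  intros HE H. induction H; eauto using conn_sym, conn_trans.
Qed.

Lemma conn_mono {V} (E E' : list (V * V)) x y : incl E E' -> conn E x y -> conn E' x y.
Proof.
  intros HE. apply (conn_map (fun v => v)). auto.
Qed.

Lemma conn_cons {V} (E : list (V * V)) a b u v :
  conn ((a, b) :: E) u v <->
  conn E u v \/ (conn E u a /\ conn E b v) \/ (conn E u b /\ conn E a v).
Proof.
  split.
  - intros H. induction H as [x y H | x | x y _ IH | x y z _ IH1 _ IH2].
    + destruct H as [H | H]; [injection H as <- <- |]; auto.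
    + auto.
    + destruct IH as [? | [[? ?] | [? ?]]]; eauto 7 using conn_sym.
    + destruct IH1 as [? | [[? ?] | [? ?]]], IH2 as [? | [[? ?] | [? ?]]];
        eauto 7 using conn_sym, conn_trans.
  - assert (M : forall x y, conn E x y -> conn ((a, b) :: E) x y)
      by (intros x y; apply conn_mono; intros z Hz; now right).
    assert (Hab : conn ((a, b) :: E) a b) by (apply conn_edge; now left).
    intros [H | [[H1 H2] | [H1 H2]]]; auto; apply M in H1, H2;
      eauto 6 using conn_trans, conn_sym.
Qed.

Lemma conn_isolated {V} (E : list (V * V)) u v :
  (forall e, In e E -> fst e <> u /\ snd e <> u) -> conn E u v -> u = v.
Proof.
  intros Hu H.
  enough (K : forall x y, conn E x y -> u = x <-> u = y) by now apply (K u v H).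
  clear v H. intros x y H.
  induction H as [x y H | x | x y _ IH | x y z _ IH1 _ IH2]; try tauto.
  destruct (Hu _ H); simpl in *; split; intros ->; contradiction.
Qed.

(** Acyclicity of an undirected multigraph, built up from the end of the list: each edge joins two
    distinct components of what follows it. Loops and parallel edges count as cycles. [forest_perm]
    shows that the order is immaterial. *)
Fixpoint forest {V : Type} (E : list (V * V)) : Prop :=
  match E with
  | [] => True
  | e :: E' => ~ conn E' (fst e) (snd e) /\ forest E'
  end.

Lemma conn_perm {V} (E E' : list (V * V)) u v :
  Permutation E E' -> conn E u v -> conn E' u v.
Proof.
  intros HP. apply conn_mono. intros z. now apply Permutation_in.
Qed.

Lemma forest_perm {V} (E E' : list (V * V)) : Permutation E E' -> forest E -> forest E'.
Proof.
  induction 1 as [| e E E' HP IH | [a b] [c d] E | E1 E2 E3 _ IH1 _ IH2]; simpl; auto.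
  - intros [H1 H2]. split; auto. intros H. apply H1.
    eapply conn_perm; [symmetry |]; eauto.
  - rewrite !conn_cons. intuition eauto 6 using conn_sym, conn_trans.
Qed.

Definition spans {V} (L : V -> Prop) (E : list (V * V)) : Prop :=
  forest E /\ forall u v, L u -> L v -> conn E u v.

Lemma spans_perm {V} (L : V -> Prop) E E' : Permutation E E' -> spans L E -> spans L E'.
Proof.
  intros HP [H1 H2]. split; eauto using forest_perm, conn_perm.
Qed.

(* Removing (i,u) leaves two components, and v lies in the one of u. *)
Lemma spans_move {V} (L : V -> Prop) i u v Z :
  L i -> L u -> L v -> spans L ((u, i) :: Z) -> ~ conn Z i v -> spans L ((v, i) :: Z).
Proof.
  intros Li Lu Lv [[F1 F2] HC] Hn. simpl in *.
  assert (Huv : conn Z u v).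
  { destruct (proj1 (conn_cons _ _ _ _ _) (HC u v Lu Lv)) as [? | [[? ?] | [? ?]]]; tauto. }
  split; [split; auto; intros H; apply Hn; now apply conn_sym |].
  intros x y Lx Ly. specialize (HC x y Lx Ly). rewrite conn_cons in *.
  destruct HC as [? | [[? ?] | [? ?]]]; eauto 7 using conn_sym, conn_trans.
Qed.

Lemma spans_flip {V} (L : V -> Prop) a b Z : spans L ((a, b) :: Z) -> spans L ((b, a) :: Z).
Proof.
  intros [[F1 F2] HC]. simpl in *. split.
  - split; auto. intros H. now apply F1, conn_sym.
  - intros x y Lx Ly. specialize (HC x y Lx Ly). rewrite conn_cons in *. tauto.
Qed.

(** * Contraction of a forest inside a graph *)

Lemma conn_contract {V W} (f : V -> W) T K x y :
  (forall e, In e T -> f (fst e) = f (snd e)) ->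
  conn (K ++ T) x y -> conn (map (fun e => (f (fst e), f (snd e))) K) (f x) (f y).
Proof.
  intros HT. apply conn_map. intros u v Huv. apply in_app_or in Huv as [Huv | Huv].
  - apply conn_edge. apply in_map_iff. now exists (u, v).
  - apply HT in Huv. simpl in Huv. rewrite Huv. auto.
Qed.

(** Here [g] selects the vertex to which a component of [T] shrinks; a connection in the contracted
    graph is lifted edge by edge, with detours along [T] through the selected vertices. *)
Lemma conn_expand {V W} (f : V -> W) (g : W -> V) T K x y :
  (forall e, In e K -> conn T (fst e) (g (f (fst e))) /\ conn T (snd e) (g (f (snd e)))) ->
  conn T x (g (f x)) -> conn T y (g (f y)) ->
  conn (map (fun e => (f (fst e), f (snd e))) K) (f x) (f y) -> conn (K ++ T) x y.
Proof.
  intros HK Hx Hy H.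
  assert (M : forall u v, conn T u v -> conn (K ++ T) u v)
    by (intros u v; apply conn_mono, incl_appr, incl_refl).
  apply conn_trans with (g (f x)); auto. apply conn_trans with (g (f y)); auto using conn_sym.
  revert H. apply conn_map. intros u v Huv. apply in_map_iff in Huv as [[a b] [Hab Hin]].
  simpl in Hab. injection Hab as <- <-. destruct (HK _ Hin) as [H1 H2]. simpl in *.
  apply conn_trans with a; [auto using conn_sym |]. apply conn_trans with b; auto.
  apply conn_edge, in_or_app. now left.
Qed.

(** Contracting a forest neither creates nor destroys cycles: the ends of an edge are connected by
    the remaining edges and [T] exactly when their images are connected by the images of the
    remaining edges. *)
Lemma forest_contract {V W} (f : V -> W) (g : W -> V) T K :
  (forall e, In e T -> f (fst e) = f (snd e)) ->
  (forall e, In e K -> conn T (fst e) (g (f (fst e))) /\ conn T (snd e) (g (f (snd e)))) ->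
  forest T ->
  forest (K ++ T) <-> forest (map (fun e => (f (fst e), f (snd e))) K).
Proof.
  intros HT HK FT. induction K as [| e K IH]; simpl; [tauto |].
  assert (HK' : forall e, In e K ->
     conn T (fst e) (g (f (fst e))) /\ conn T (snd e) (g (f (snd e))))
    by (intros; apply HK; now right).
  destruct (HK e (or_introl eq_refl)).
  rewrite IH by auto. split; intros [H1 H2]; split; auto; intros HC; apply H1.
  - now apply (conn_expand f g).
  - now apply conn_contract with T.
Qed.

(** Each edge attaches a vertex that no later edge touches. This is a local certificate for [forest]
    that survives concatenation under simple disjointness conditions. *)
Fixpoint fresh_heads {V : Type} (T : list (V * V)) : Prop :=
  match T with
  | [] => True
  | e :: T' => fst e <> snd e
      /\ (forall e', In e' T' -> fst e' <> fst e /\ snd e' <> fst e) /\ fresh_heads T'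
  end.

Lemma fresh_heads_forest {V} (T : list (V * V)) : fresh_heads T -> forest T.
Proof.
  induction T as [| e T IH]; simpl; auto. intros (H1 & H2 & H3). split; auto.
  intros H. apply H1. eapply conn_isolated; eauto.
Qed.

Lemma fresh_heads_app {V} (T1 T2 : list (V * V)) :
  fresh_heads T1 -> fresh_heads T2 ->
  (forall e1 e2, In e1 T1 -> In e2 T2 -> fst e2 <> fst e1 /\ snd e2 <> fst e1) ->
  fresh_heads (T1 ++ T2).
Proof.
  induction T1 as [| e T IH]; simpl; auto. intros (H1 & H2 & H3) HF H.
  repeat split; auto.
  - apply in_app_or in H0 as [H0 | H0]; [now apply H2 | now apply H; auto].
  - apply in_app_or in H0 as [H0 | H0]; [now apply H2 | now apply H; auto].
Qed.

(** * Trails and forests *)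

Definition keptb (s : switching) (e : edge) : bool :=
  match e_tag e with None => true | Some (v, b) => Bool.eqb (s v) b end.

Lemma keptbP s e : keptb s e = true <-> kept s e.
Proof.
  unfold keptb, kept. destruct (e_tag e) as [[v b] |]; [apply Bool.eqb_true_iff | tauto].
Qed.

Definition ends (e : edge) : vertex * vertex := (e_src e, e_dst e).

Definition kedges (s : switching) (E : list edge) : list (vertex * vertex) :=
  map ends (filter (keptb s) E).

Lemma kedges_app s E E' : kedges s (E ++ E') = kedges s E ++ kedges s E'.
Proof. unfold kedges. now rewrite filter_app, map_app. Qed.

Lemma in_kedges s E u v : In (u, v) (kedges s E) <-> adj E (kept s) u v.
Proof.
  unfold kedges, adj. rewrite in_map_iff. split.
  - intros (e & He & H). apply filter_In in H as [H1 H2]. apply keptbP in H2.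
    injection He as <- <-. eauto.
  - intros (e & H1 & H2 & <- & <-). exists e. split; auto. apply filter_In.
    now rewrite keptbP.
Qed.

Lemma connected_kedges s E u v : connected_in E (kept s) u v <-> conn (kedges s E) u v.
Proof.
  split; intros H; induction H as [x y H | x | x y _ IH | x y z _ IH1 _ IH2].
  2,6: apply rst_refl.
  2,5: now apply rst_sym.
  2,4: now apply rst_trans with y.
  - apply rst_step. now apply in_kedges.
  - apply rst_step. now apply in_kedges in H.
Qed.

Lemma trail_app E k es1 es2 u v w :
  trail E k u v es1 -> trail E k v w es2 -> trail E k u w (es1 ++ es2).
Proof.
  revert u. induction es1 as [| n es IH]; simpl; intros u H1 H2; [now subst |].
  destruct H1 as (e & He & Hk & [[H H'] | [H H']]); exists e; repeat split; auto.
Qed.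

Lemma trail_split E k es1 es2 u w :
  trail E k u w (es1 ++ es2) -> exists v, trail E k u v es1 /\ trail E k v w es2.
Proof.
  revert u. induction es1 as [| n es IH]; simpl; intros u H; eauto.
  destruct H as (e & He & Hk & [[H H'] | [H H']]); destruct (IH _ H') as (v & ? & ?);
    exists v; split; eauto 8.
Qed.

Lemma trail_conn E s es u v : trail E (kept s) u v es -> conn (kedges s E) u v.
Proof.
  revert u. induction es as [| n es IH]; simpl; intros u H; [subst; auto |].
  destruct H as (e & He & Hk & H). apply nth_error_In in He.
  assert (conn (kedges s E) (e_src e) (e_dst e))
    by (apply conn_edge, in_kedges; exists e; auto).
  destruct H as [[<- H] | [<- H]]; apply IH in H; eauto using conn_sym, conn_trans.
Qed.

Lemma trail_shift E k e es u v :
  trail (e :: E) k u v (map S es) <-> trail E k u v es.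
Proof.
  revert u. induction es as [| n es IH]; simpl; intros u; [tauto |].
  split; intros (f & Hf & Hk & H); exists f; repeat split; auto;
    destruct H as [[? H] | [? H]]; [left | right | left | right]; split; auto; now apply IH.
Qed.

Lemma unshift es : ~ In 0 es -> exists es', es = map S es'.
Proof.
  induction es as [| [| n] es IH]; simpl; intros H.
  - now exists [].
  - tauto.
  - destruct IH as [es' ->]; [tauto |]. now exists (n :: es').
Qed.

(** Both ends of a trail are connected to any edge on it. Two trails with a common edge therefore
    connect all their ends to each other. *)
Lemma trail_mid_conn E s es u v n :
  trail E (kept s) u v es -> In n es ->
  exists e, nth_error E n = Some e /\ conn (kedges s E) u (e_src e) /\ conn (kedges s E) v (e_src e).
Proof.
  intros H Hn. apply in_split in Hn as (es1 & es2 & ->).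
  apply trail_split in H as (w & H1 & H2). apply trail_conn in H1.
  assert (H2' := trail_conn _ _ _ _ _ H2). simpl in H2.
  destruct H2 as (e & He & Hk & H). exists e. split; auto.
  assert (conn (kedges s E) w (e_src e)).
  { destruct H as [[<- _] | [<- _]]; auto. apply conn_sym, conn_edge, in_kedges. exists e.
    apply nth_error_In in He. auto. }
  split; eauto using conn_trans, conn_sym.
Qed.

Lemma in_map_S_0 l : ~ In 0 (map S l).
Proof. intros H. apply in_map_iff in H as (? & ? & ?). discriminate. Qed.

Lemma NoDup_map_S l : NoDup l -> NoDup (map S l).
Proof.
  intros H. apply NoDup_map_NoDup_ForallPairs; auto. intros x y _ _. congruence.
Qed.

(** Induction on the edges. A connection through the head edge yields two trails in the tail. If
    these share an edge, their outer ends are already connected in the tail and the head edge is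
    dispensed with; otherwise the concatenation through the head edge has no repetition. *)
Lemma conn_trail s E u v :
  conn (kedges s E) u v -> exists es, NoDup es /\ trail E (kept s) u v es.
Proof.
  revert u v. induction E as [| e E IH]; intros u v H.
  - exists []. split; [constructor |]. simpl. now apply (conn_isolated [] u v).
  - assert (Hshift : conn (kedges s E) u v ->
      exists es, NoDup es /\ trail (e :: E) (kept s) u v es).
    { intros H'. apply IH in H' as (es & N & T). exists (map S es). split.
      - now apply NoDup_map_S.
      - now apply trail_shift. }
    unfold kedges in H. simpl in H. destruct (keptb s e) eqn:He; [| auto].
    simpl in H. unfold ends in H at 1. apply conn_cons in H. apply keptbP in He.
    destruct H as [H | H]; [auto |].
    assert (Hsplit : forall a b, conn (kedges s E) u a -> conn (kedges s E) b v ->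
       ((e_src e = a /\ e_dst e = b) \/ (e_dst e = a /\ e_src e = b)) ->
       exists es, NoDup es /\ trail (e :: E) (kept s) u v es).
    { intros a b Ha Hb Hab. apply IH in Ha as (es1 & N1 & T1). apply IH in Hb as (es2 & N2 & T2).
      destruct (List.Exists_dec (fun n => In n es2) es1 (fun n => in_dec Nat.eq_dec n es2)) as [X | X].
      - apply Exists_exists in X as (n & X1 & X2). apply Hshift.
        destruct (trail_mid_conn _ _ _ _ _ _ T1 X1) as (e1 & Q1 & Q2 & Q3).
        destruct (trail_mid_conn _ _ _ _ _ _ T2 X2) as (e2 & R1 & R2 & R3).
        replace e2 with e1 in * by congruence. eauto using conn_trans, conn_sym.
      - exists (map S es1 ++ 0 :: map S es2). split.
        + apply NoDup_Add with (a := 0) (l := map S es1 ++ map S es2).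
          * apply Add_app.
          * split.
            -- rewrite <- map_app. apply NoDup_map_S. apply NoDup_app; auto.
               intros n Hn Hn'. apply X, Exists_exists. eauto.
            -- rewrite <- map_app. apply in_map_S_0.
        + eapply trail_app; [apply trail_shift; eauto |]. simpl. exists e. repeat split; auto.
          destruct Hab as [[H1 H2] | [H1 H2]]; [left | right]; split; auto;
            rewrite H2; now apply trail_shift. }
    destruct H as [[H1 H2] | [H1 H2]]; eapply Hsplit; eauto.
Qed.

(** A cycle either avoids the head edge, and then lies in the tail, or is broken at it, and then its
    two remaining pieces connect the ends of that edge in the tail. *)
Lemma acyclic_forest s E : ~ has_cycle E (kept s) <-> forest (kedges s E).
Proof.
  induction E as [| e E IH].
  - split; [now simpl |]. intros _ (u & [| n es] & H & _ & T); [easy |].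
    destruct T as (e & He & _). now destruct n.
  - assert (Hs : has_cycle E (kept s) -> has_cycle (e :: E) (kept s)).
    { intros (u & es & H & N & T). exists u, (map S es). repeat split.
      - now destruct es.
      - now apply NoDup_map_S.
      - now apply trail_shift. }
    unfold kedges. simpl. destruct (keptb s e) eqn:He.
    + simpl. fold (kedges s E). rewrite <- IH. apply keptbP in He. split.
      * intros H. split; [| tauto]. intros HC. apply H. apply conn_sym, conn_trail in HC as (es & N & T).
        exists (e_src e), (0 :: map S es). repeat split; [easy | |].
        -- constructor; [apply in_map_S_0 | now apply NoDup_map_S].
        -- simpl. exists e. repeat split; auto. left. split; auto. now apply trail_shift.
      * intros [H1 H2] (u & es & Hne & N & T).
        destruct (in_dec Nat.eq_dec 0 es) as [H0 | H0].
        -- apply in_split in H0 as (es1 & es2 & ->).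
           assert (H0 : ~ In 0 (es1 ++ es2)) by now apply NoDup_remove_2.
           destruct (unshift es1) as [l1 ->]; [intros X; apply H0, in_or_app; auto |].
           destruct (unshift es2) as [l2 ->]; [intros X; apply H0, in_or_app; auto |].
           apply trail_split in T as (w & T1 & (f & Hf & _ & T2)).
           simpl in Hf. injection Hf as <-. apply H1.
           apply trail_shift, trail_conn in T1.
           destruct T2 as [[<- T2] | [<- T2]]; apply trail_shift, trail_conn in T2;
             eauto using conn_sym, conn_trans.
        -- destruct (unshift es H0) as [l ->]. apply H2. exists u, l. repeat split.
           ++ now destruct l.
           ++ now apply NoDup_map_inv in N.
           ++ now apply trail_shift in T.
    + fold (kedges s E). rewrite <- IH. split; [tauto |].
      intros H2 (u & es & Hne & N & T).
      destruct (in_dec Nat.eq_dec 0 es) as [H0 | H0].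
      * apply in_split in H0 as (es1 & es2 & ->).
        apply trail_split in T as (w & T1 & (f & Hf & Hk & _)).
        simpl in Hf. injection Hf as <-. apply keptbP in Hk. congruence.
      * destruct (unshift es H0) as [l ->]. apply H2. exists u, l. repeat split.
        -- now destruct l.
        -- now apply NoDup_map_inv in N.
        -- now apply trail_shift in T.
Qed.

(** * Outcomes of switchings on leaves *)

(* A common shape for linkings, formulas and cuts.  Under a switching every
   subtree is represented by a leaf connected to its root; in [TTens d A B] the
   value of [d] at the switch of the node tells which side provides it. *)
Inductive tr : Type :=
| TLeaf (i : nat)
| TTens (d : bool -> bool) (A B : tr)
| TPar (A B : tr).

Definition shift (s : list bool -> bool) (b : bool) : list bool -> bool := fun q => s (b :: q).

Fixpoint trep (s : list bool -> bool) (t : tr) : nat :=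
  match t with
  | TLeaf i => i
  | TTens d A B => if d (s []) then trep (shift s true) B else trep (shift s false) A
  | TPar A B => if s [] then trep (shift s true) B else trep (shift s false) A
  end.

(** A ⅋ contributes no edge: the discarded premise is detached from the node, and the other one
    shares its representative. The edge of a tensor node starts at the representative of the whole,
    so ⊥s tensored to one root form a star around it. *)
Fixpoint tE (s : list bool -> bool) (t : tr) : list (nat * nat) :=
  match t with
  | TLeaf _ => []
  | TTens d A B =>
      (if d (s []) then (trep (shift s true) B, trep (shift s false) A)
       else (trep (shift s false) A, trep (shift s true) B))
      :: tE (shift s false) A ++ tE (shift s true) B
  | TPar A B => tE (shift s false) A ++ tE (shift s true) B
  end.

Fixpoint tleaves (t : tr) : list nat :=
  match t with
  | TLeaf i => [i]
  | TTens _ A B | TPar A B => tleaves A ++ tleaves B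
  end.

Fixpoint tsub (q : list bool) (t : tr) : option tr :=
  match q, t with
  | [], _ => Some t
  | _ :: _, TLeaf _ => None
  | b :: q', TTens _ A B | b :: q', TPar A B => tsub q' (if b then B else A)
  end.

Definition tnode (mk : list bool -> vertex) (p : list bool) (t : tr) : vertex :=
  match t with TLeaf i => VL i | _ => mk p end.

Fixpoint tedges (mk : list bool -> vertex) (p : list bool) (t : tr) : list edge :=
  match t with
  | TLeaf _ => []
  | TTens _ A B =>
      Edge (mk p) (tnode mk (p ++ [false]) A) None
      :: Edge (mk p) (tnode mk (p ++ [true]) B) None
      :: tedges mk (p ++ [false]) A ++ tedges mk (p ++ [true]) B
  | TPar A B =>
      Edge (mk p) (tnode mk (p ++ [false]) A) (Some (mk p, false))
      :: Edge (mk p) (tnode mk (p ++ [true]) B) (Some (mk p, true))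
      :: tedges mk (p ++ [false]) A ++ tedges mk (p ++ [true]) B
  end.

Fixpoint tverts (mk : list bool -> vertex) (p : list bool) (t : tr) : list vertex :=
  match t with
  | TLeaf i => [VL i]
  | TTens _ A B | TPar A B =>
      mk p :: tverts mk (p ++ [false]) A ++ tverts mk (p ++ [true]) B
  end.

(** The otherwise idle switch bit of an axiom link selects which end represents it; this freedom
    lets a connection to either end reach the root. A ⊥ never represents its node, so it is a
    pendant edge at the representative of its side premise. *)
Fixpoint l2t (P : linking) : tr :=
  match P with
  | LOne i => TLeaf i
  | LAxPN _ i j | LAxNP _ i j => TTens (fun b => b) (TLeaf i) (TLeaf j)
  | LBotL i Q => TTens (fun _ => true) (TLeaf i) (l2t Q)
  | LBotR Q i => TTens (fun _ => false) (l2t Q) (TLeaf i)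
  | LPar Q R => TPar (l2t Q) (l2t R)
  end.

Fixpoint f2t (A : form) : tr :=
  match A with
  | FLeaf i _ => TLeaf i
  | FTens A B => TTens (fun _ => false) (f2t A) (f2t B)
  | FPar A B => TPar (f2t A) (f2t B)
  end.

Definition e2t (e : entry) : tr :=
  match e with
  | EForm A => f2t A
  | ECut A B => TTens (fun _ => false) (f2t A) (f2t B)
  end.

Lemma fnode_tnode k p A : fnode k p A = tnode (VG k) p (f2t A).
Proof. now destruct A. Qed.

Lemma fedges_tedges k p A : fedges k p A = tedges (VG k) p (f2t A).
Proof.
  revert p. induction A as [i l | A IHA B IHB | A IHA B IHB]; intros p; simpl; auto;
    now rewrite !fnode_tnode, IHA, IHB.
Qed.

Lemma fverts_tverts k p A : fverts k p A = tverts (VG k) p (f2t A).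
Proof.
  revert p. induction A as [i l | A IHA B IHB | A IHA B IHB]; intros p; simpl; auto;
    now rewrite IHA, IHB.
Qed.

Lemma entry_edges_tedges k e : entry_edges k e = tedges (VG k) [] (e2t e).
Proof. destruct e; simpl; now rewrite ?fnode_tnode, !fedges_tedges. Qed.

Lemma entry_verts_tverts k e : entry_verts k e = tverts (VG k) [] (e2t e).
Proof. destruct e; simpl; now rewrite !fverts_tverts. Qed.

Lemma lnode_tnode p P : lnode p P = tnode VP p (l2t P).
Proof. now destruct P. Qed.

Lemma ledges_tedges p P : ledges p P = tedges VP p (l2t P).
Proof.
  revert p. induction P; intros p; simpl; rewrite ?lnode_tnode, ?IHP, ?IHP1, ?IHP2, ?app_nil_r; auto.
Qed.

Lemma in_lverts v p P : In v (lverts p P) <-> In v (tverts VP p (l2t P)).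
Proof.
  revert p. induction P; intros p; simpl; rewrite ?in_app_iff, ?IHP, ?IHP1, ?IHP2; simpl; tauto.
Qed.

Lemma tleaves_f2t A : tleaves (f2t A) = map fst (fleaves A).
Proof. induction A; simpl; auto; now rewrite map_app, IHA1, IHA2. Qed.

Lemma tleaves_e2t e : tleaves (e2t e) = map fst (eleaves e).
Proof. destruct e; simpl; now rewrite ?map_app, !tleaves_f2t. Qed.

Lemma tleaves_l2t P : tleaves (l2t P) = map fst (lleaves P).
Proof.
  induction P; simpl; rewrite ?map_app, ?IHP, ?IHP1, ?IHP2; auto.
Qed.

Lemma tnode_in mk p t : In (tnode mk p t) (tverts mk p t).
Proof. destruct t; simpl; auto. Qed.

Lemma tleaves_verts mk p t i : In i (tleaves t) -> In (VL i) (tverts mk p t).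
Proof.
  revert p. induction t; intros p; simpl; rewrite ?in_app_iff; intros [|]; subst; auto; tauto.
Qed.

Lemma trep_leaf s t : In (trep s t) (tleaves t).
Proof.
  revert s. induction t; intros s; simpl; auto; rewrite in_app_iff;
    [destruct (d (s [])) | destruct (s [])]; auto.
Qed.

Lemma tsub_leaves q t u i : tsub q t = Some u -> In i (tleaves u) -> In i (tleaves t).
Proof.
  revert t. induction q as [| b q IH]; intros t H Hi; [destruct t; now injection H as -> |].
  destruct t as [j | d A B | A B]; simpl in *; [discriminate | |];
    rewrite in_app_iff; destruct b; eauto.
Qed.

Lemma tverts_inv mk p t v :
  In v (tverts mk p t) ->
  (exists i, v = VL i /\ In i (tleaves t)) \/ (exists q u, v = mk (p ++ q) /\ tsub q t = Some u).
Proof.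
  assert (H0 : forall p t, (exists q u, mk p = mk (p ++ q) /\ tsub q t = Some u))
    by (intros p' t'; exists [], t'; now rewrite app_nil_r; destruct t').
  revert p. induction t as [i | d A IHA B IHB | A IHA B IHB]; intros p; simpl;
    [intros [<- | []]; eauto | |];
    (intros [<- | H]; [now right; apply H0 |]; apply in_app_or in H as [H | H];
      [apply IHA in H as [(i & -> & H) | (q & u & -> & H)]
      |apply IHB in H as [(i & -> & H) | (q & u & -> & H)]];
      [left; exists i; rewrite in_app_iff; auto
      |right; exists (false :: q), u; rewrite <- app_assoc; auto
      |left; exists i; rewrite in_app_iff; auto
      |right; exists (true :: q), u; rewrite <- app_assoc; auto]).
Qed.

(** * Contracting a switching onto its leaves *)

(* The kept edges E split into a forest T, along which each vertex v is joined
   to its representative leaf f v, and a rest K which f maps to the edges A. *)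
Definition contraction (f : vertex -> nat) (own : vertex -> Prop)
    (E : list (vertex * vertex)) (vs : list vertex) (ls : list nat) (A : list (nat * nat)) : Prop :=
  exists T K, Permutation E (K ++ T) /\ fresh_heads T /\
    (forall e, In e T -> own (fst e) /\ (own (snd e) \/ exists i, snd e = VL i)
                         /\ f (fst e) = f (snd e)) /\
    (forall v, In v vs -> conn T v (VL (f v)) /\ In (f v) ls) /\
    (forall e, In e K -> In (fst e) vs /\ In (snd e) vs) /\
    map (fun e => (f (fst e), f (snd e))) K = A.

(** The two graphs may share leaf vertices only. No forest edge of the first starts at a leaf, and
    the owned vertices are disjoint, so the heads of the first forest stay fresh with respect to the
    second. *)
Lemma contraction_app f own1 own2 own E1 E2 vs1 vs2 ls1 ls2 A1 A2 :
  contraction f own1 E1 vs1 ls1 A1 -> contraction f own2 E2 vs2 ls2 A2 ->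
  (forall v, own1 v -> own v) -> (forall v, own2 v -> own v) ->
  (forall v, own1 v -> ~ own2 v) -> (forall i, ~ own1 (VL i)) ->
  contraction f own (E1 ++ E2) (vs1 ++ vs2) (ls1 ++ ls2) (A1 ++ A2).
Proof.
  intros (T1 & K1 & P1 & F1 & O1 & V1 & B1 & M1) (T2 & K2 & P2 & F2 & O2 & V2 & B2 & M2) H1 H2 HD HL.
  exists (T1 ++ T2), (K1 ++ K2). split; [| split; [| split; [| split; [| split]]]].
  - rewrite P1, P2, <- !app_assoc. apply Permutation_app_head.
    rewrite !app_assoc. apply Permutation_app_tail, Permutation_app_comm.
  - apply fresh_heads_app; auto. intros e1 e2 I1 I2.
    destruct (O1 _ I1) as (X1 & _ & _), (O2 _ I2) as (X2 & X3 & _). split; intros E.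
    + rewrite E in X2. now apply (HD _ X1).
    + rewrite E in X3. destruct X3 as [X3 | [i X3]]; [now apply (HD _ X1) |].
      rewrite X3 in X1. now apply (HL i).
  - intros e He. apply in_app_or in He as [He | He];
      [destruct (O1 _ He) as (? & [? | ?] & ?) | destruct (O2 _ He) as (? & [? | ?] & ?)]; auto.
  - intros v Hv. rewrite in_app_iff. apply in_app_or in Hv as [Hv | Hv];
      [destruct (V1 _ Hv) as [C ?] | destruct (V2 _ Hv) as [C ?]]; split; auto;
      revert C; apply conn_mono; auto using incl_appl, incl_appr, incl_refl.
  - intros e He. rewrite !in_app_iff. apply in_app_or in He as [He | He];
      [destruct (B1 _ He) | destruct (B2 _ He)]; auto.
  - rewrite map_app. congruence.
Qed.

(** The edge from a node to the child that provides its representative joins the forest, with the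
    node as a fresh head. *)
Lemma contraction_node f own own' E vs ls A v c :
  contraction f own E vs ls A -> In c vs -> f v = f c ->
  (own' v /\ ~ own v /\ forall i, v <> VL i) ->
  (forall u, own u -> own' u) -> (own c \/ exists i, c = VL i) ->
  contraction f own' ((v, c) :: E) (v :: vs) ls A.
Proof.
  intros (T & K & P & F & O & V & B & M) Hc Hf (N1 & N2 & N3) HO Hoc.
  exists ((v, c) :: T), K.
  assert (Q : forall x y, conn T x y -> conn ((v, c) :: T) x y)
    by (intros x y; apply conn_mono; intros z; now right).
  assert (Hvc : v <> c) by (intros <-; destruct Hoc as [? | [i ?]]; [tauto | now apply (N3 i)]).
  split; [| split; [| split; [| split; [| split]]]].
  - rewrite P. apply Permutation_middle.
  - simpl. repeat split; auto; destruct (O _ H) as (X & Y & _); intros E1; rewrite E1 in *; [tauto |].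
    destruct Y as [? | [i ?]]; [tauto | now apply (N3 i)].
  - intros e [<- | He]; simpl.
    + repeat split; auto. destruct Hoc as [? | ?]; auto.
    + destruct (O _ He) as (? & [? | ?] & ?); auto.
  - intros u [<- | Hu].
    + rewrite Hf. destruct (V _ Hc). split; auto.
      apply conn_trans with c; auto. apply conn_edge. now left.
    + destruct (V _ Hu). auto.
  - intros e He. destruct (B _ He). simpl. auto.
  - auto.
Qed.

(** For the other edge of a tensor node, which survives as an edge between two representatives. *)
Lemma contraction_edge f own E vs ls A u w :
  contraction f own E vs ls A -> In u vs -> In w vs ->
  contraction f own ((u, w) :: E) vs ls ((f u, f w) :: A).
Proof.
  intros (T & K & P & F & O & V & B & M) Hu Hw.
  exists T, ((u, w) :: K). split; [| split; [| split; [| split; [| split]]]]; auto.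
  - simpl. now rewrite P.
  - intros e [<- | He]; auto.
  - simpl. congruence.
Qed.

Lemma contraction_perm f own E E' vs ls A :
  Permutation E E' -> contraction f own E vs ls A -> contraction f own E' vs ls A.
Proof.
  intros HP (T & K & P & H). exists T, K. split; auto. now rewrite <- HP.
Qed.

Definition below (mk : list bool -> vertex) (p : list bool) (v : vertex) : Prop :=
  exists q, v = mk (p ++ q).

Definition strictly_below (mk : list bool -> vertex) (p : list bool) (v : vertex) : Prop :=
  exists b q, v = mk (p ++ b :: q).

Lemma contraction_children mk f p E1 E2 vs1 vs2 ls1 ls2 A1 A2 :
  (forall q q', mk q = mk q' -> q = q') -> (forall q i, mk q <> VL i) ->
  contraction f (below mk (p ++ [false])) E1 vs1 ls1 A1 ->
  contraction f (below mk (p ++ [true])) E2 vs2 ls2 A2 ->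
  contraction f (strictly_below mk p) (E1 ++ E2) (vs1 ++ vs2) (ls1 ++ ls2) (A1 ++ A2).
Proof.
  intros Hinj HVL C1 C2. apply (contraction_app _ _ _ _ _ _ _ _ _ _ _ _ C1 C2).
  - intros v (q & ->). rewrite <- app_assoc. now exists false, q.
  - intros v (q & ->). rewrite <- app_assoc. now exists true, q.
  - intros v (q & ->) (q' & E). apply Hinj in E. rewrite <- !app_assoc in E.
    apply app_inv_head in E. discriminate.
  - intros i (q & E). symmetry in E. now apply HVL in E.
Qed.

Lemma contraction_root mk f p b t E vs ls A :
  (forall q q', mk q = mk q' -> q = q') -> (forall q i, mk q <> VL i) ->
  contraction f (strictly_below mk p) E vs ls A ->
  In (tnode mk (p ++ [b]) t) vs -> f (mk p) = f (tnode mk (p ++ [b]) t) ->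
  contraction f (below mk p) ((mk p, tnode mk (p ++ [b]) t) :: E) (mk p :: vs) ls A.
Proof.
  intros Hinj HVL C Ht Hf. apply (contraction_node _ _ _ _ _ _ _ _ _ C Ht Hf).
  - repeat split; auto.
    + exists []. now rewrite app_nil_r.
    + intros (b' & q & E'). apply Hinj in E'. rewrite <- (app_nil_r p) in E' at 1.
      apply app_inv_head in E'. discriminate.
  - intros u (b' & q & ->). now exists (b' :: q).
  - destruct t; simpl; [right; eauto | left | left]; now exists b, [].
Qed.

Lemma tree_contraction mk S f :
  (forall q q', mk q = mk q' -> q = q') -> (forall q i, mk q <> VL i) -> (forall i, f (VL i) = i) ->
  forall t p s, (forall q, S (mk (p ++ q)) = s q) ->
    (forall q u, tsub q t = Some u -> f (mk (p ++ q)) = trep (fun q' => s (q ++ q')) u) ->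
    contraction f (below mk p) (kedges S (tedges mk p t)) (tverts mk p t) (tleaves t) (tE s t).
Proof.
  intros Hinj HVL HfL t.
  assert (Hnode : forall t p s,
    (forall q u, tsub q t = Some u -> f (mk (p ++ q)) = trep (fun q' => s (q ++ q')) u) ->
    f (tnode mk p t) = trep s t).
  { intros t' p' s' H. specialize (H [] t'). rewrite app_nil_r in H.
    destruct t'; simpl in *; auto. }
  induction t as [i | d A IHA B IHB | A IHA B IHB]; intros p s HS Hf.
  { exists [], []. simpl. repeat split; auto; try easy.
    - destruct H as [<- | []]. rewrite HfL. auto.
    - left. destruct H as [<- | []]. now rewrite HfL. }
  all: assert (fA : forall q u, tsub q A = Some u ->
         f (mk ((p ++ [false]) ++ q)) = trep (fun q' => shift s false (q ++ q')) u)
      by (intros q u H; rewrite <- app_assoc; now apply (Hf (false :: q))).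
  all: assert (fB : forall q u, tsub q B = Some u ->
         f (mk ((p ++ [true]) ++ q)) = trep (fun q' => shift s true (q ++ q')) u)
      by (intros q u H; rewrite <- app_assoc; now apply (Hf (true :: q))).
  all: assert (SA : forall q, S (mk ((p ++ [false]) ++ q)) = shift s false q)
      by (intros q; rewrite <- app_assoc; apply (HS (false :: q))).
  all: assert (SB : forall q, S (mk ((p ++ [true]) ++ q)) = shift s true q)
      by (intros q; rewrite <- app_assoc; apply (HS (true :: q))).
  all: assert (C := contraction_children _ _ _ _ _ _ _ _ _ _ _ Hinj HVL
         (IHA _ _ SA fA) (IHB _ _ SB fB)); rewrite <- kedges_app in C.
  all: assert (NA := Hnode _ _ _ fA); assert (NB := Hnode _ _ _ fB);
    assert (Hp := Hf [] _ eq_refl); rewrite app_nil_r in Hp.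
  all: assert (HA := in_or_app _ (tverts mk (p ++ [true]) B) _ (or_introl (tnode_in mk (p ++ [false]) A)));
    assert (HB := in_or_app (tverts mk (p ++ [false]) A) _ _ (or_intror (tnode_in mk (p ++ [true]) B))).
  - change (f (mk p) = trep s (TTens d A B)) in Hp.
    unfold kedges. simpl. fold (kedges S (tedges mk (p ++ [false]) A ++ tedges mk (p ++ [true]) B)).
    unfold ends. simpl in *. destruct (d (s [])).
    + rewrite <- NA, <- NB. replace (f (tnode mk (p ++ [true]) B)) with (f (mk p)) by congruence.
      apply contraction_edge; [| now left | now right].
      apply contraction_root; auto. congruence.
    + rewrite <- NA, <- NB. replace (f (tnode mk (p ++ [false]) A)) with (f (mk p)) by congruence.
      (* Child edges are listed left first, but here the left one belongs to the forest and must be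
         added before the right one. *)
      eapply contraction_perm; [apply perm_swap |].
      apply contraction_edge; [| now left | now right].
      apply contraction_root; auto. congruence.
  - assert (HSp : S (mk p) = s []) by (rewrite <- HS; now rewrite app_nil_r).
    change (f (mk p) = trep s (TPar A B)) in Hp. simpl in Hp.
    unfold kedges. simpl. unfold keptb at 1. simpl. rewrite HSp.
    destruct (s []); simpl; unfold keptb at 1; simpl; rewrite HSp; simpl;
      fold (kedges S (tedges mk (p ++ [false]) A ++ tedges mk (p ++ [true]) B));
      unfold ends; simpl; apply contraction_root; auto; congruence.
Qed.

Fixpoint sE (sg : nat -> list bool -> bool) (G : sequent) : list (nat * nat) :=
  match G with
  | [] => []
  | e :: G' => tE (sg 0) (e2t e) ++ sE (fun k => sg (S k)) G'
  end.

Lemma sequent_contraction Sw f :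
  (forall i, f (VL i) = i) ->
  forall G k sg, (forall n q, Sw (VG (k + n) q) = sg n q) ->
    (forall n e q u, nth_error G n = Some e -> tsub q (e2t e) = Some u ->
       f (VG (k + n) q) = trep (fun q' => sg n (q ++ q')) u) ->
    contraction f (fun v => exists n q, v = VG (k + n) q)
      (kedges Sw (seq_edges k G)) (seq_verts k G) (map fst (sleaves G)) (sE sg G).
Proof.
  intros HfL G. induction G as [| e G IH]; intros k sg HS Hf.
  - exists [], []. simpl. repeat split; auto; easy.
  - unfold sleaves. simpl. rewrite kedges_app, map_app, <- tleaves_e2t, entry_edges_tedges, entry_verts_tverts.
    eapply contraction_app with (own1 := fun v => exists q, v = VG k ([] ++ q)).
    + apply tree_contraction; auto; try congruence.
      * intros q. rewrite <- HS. now rewrite Nat.add_0_r.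
      * intros q u H. rewrite <- (Hf 0 e q u eq_refl H), Nat.add_0_r. reflexivity.
    + apply IH.
      * intros n q. rewrite <- HS. now rewrite Nat.add_succ_r.
      * intros n e' q u H1 H2. rewrite <- (Hf (S n) e' q u H1 H2). now rewrite Nat.add_succ_r.
    + intros v (q & ->). exists 0, q. now rewrite Nat.add_0_r.
    + intros v (n & q & ->). exists (S n), q. now rewrite Nat.add_succ_r.
    + intros v (q & ->) (n & q' & E). injection E as E. lia.
    + intros i (q & E). discriminate.
Qed.

(** The default 0 is reached only at addresses outside the graph. *)
Definition rep (Sw : switching) (P : linking) (G : sequent) (v : vertex) : nat :=
  match v with
  | VL i => i
  | VP q => match tsub q (l2t P) with
            | Some u => trep (fun q' => Sw (VP (q ++ q'))) u
            | None => 0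
            end
  | VG k q => match nth_error G k with
              | Some e => match tsub q (e2t e) with
                          | Some u => trep (fun q' => Sw (VG k (q ++ q'))) u
                          | None => 0
                          end
              | None => 0
              end
  end.

Definition outE (Sw : switching) (P : linking) (G : sequent) : list (nat * nat) :=
  tE (fun q => Sw (VP q)) (l2t P) ++ sE (fun k q => Sw (VG k q)) G.

Lemma graph_contraction Sw P G :
  contraction (rep Sw P G) (fun v => forall i, v <> VL i)
    (kedges Sw (gedges (P, G))) (tverts VP [] (l2t P) ++ seq_verts 0 G)
    (map fst (lleaves P) ++ map fst (sleaves G)) (outE Sw P G).
Proof.
  unfold gedges, outE. simpl. rewrite kedges_app, ledges_tedges, <- tleaves_l2t.
  eapply contraction_app with (own1 := fun v => exists q, v = VP ([] ++ q)).
  - apply tree_contraction; auto; try congruence. intros q u H. simpl. now rewrite H.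
  - apply sequent_contraction; auto. intros n e q u H1 H2. simpl. now rewrite H1, H2.
  - intros v (q & ->). congruence.
  - intros v (n & q & ->). congruence.
  - intros v (q & ->) (n & q' & E). discriminate.
  - intros i (q & E). discriminate.
Qed.

Lemma in_gverts v P G : In v (gverts (P, G)) <-> In v (tverts VP [] (l2t P) ++ seq_verts 0 G).
Proof. unfold gverts. simpl. now rewrite !in_app_iff, in_lverts. Qed.

Lemma graph_conn_rep Sw P G u v :
  connected_in (gedges (P, G)) (kept Sw) u v ->
  conn (outE Sw P G) (rep Sw P G u) (rep Sw P G v).
Proof.
  rewrite connected_kedges. intros H.
  destruct (graph_contraction Sw P G) as (T & K & HP & F & O & V & B & M).
  rewrite <- M. apply conn_contract with T; [| now apply (conn_perm _ _ _ _ HP)].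
  intros e He. now apply O.
Qed.

Lemma graph_conn Sw P G u v :
  In u (gverts (P, G)) -> In v (gverts (P, G)) ->
  conn (outE Sw P G) (rep Sw P G u) (rep Sw P G v) ->
  connected_in (gedges (P, G)) (kept Sw) u v.
Proof.
  rewrite !in_gverts, connected_kedges. intros Hu Hv.
  destruct (graph_contraction Sw P G) as (T & K & HP & F & O & V & B & M).
  rewrite <- M. intros H. apply (conn_perm (K ++ T)); [now symmetry |].
  apply (conn_expand (rep Sw P G) VL); auto.
  - intros e He. destruct (B _ He). split; now apply V.
  - now apply V.
  - now apply V.
Qed.

Lemma graph_forest Sw P G : forest (kedges Sw (gedges (P, G))) <-> forest (outE Sw P G).
Proof.
  destruct (graph_contraction Sw P G) as (T & K & HP & F & O & V & B & M).
  rewrite <- M, <- (forest_contract (rep Sw P G) VL T K).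
  - split; apply forest_perm; auto. now symmetry.
  - intros e He. now apply O.
  - intros e He. destruct (B _ He). split; now apply V.
  - now apply fresh_heads_forest.
Qed.

Definition leaf_of (P : linking) (i : nat) : Prop := In i (map fst (lleaves P)).

(** Every vertex is connected to its representative leaf, so connectivity of the leaves suffices for
    that of all vertices. *)
Lemma switching_correct_spans P G :
  (forall i, In i (map fst (sleaves G)) -> leaf_of P i) ->
  switching_correct (P, G) <-> forall Sw, spans (leaf_of P) (outE Sw P G).
Proof.
  intros HG. unfold switching_correct, spans.
  assert (HL : forall i, leaf_of P i -> In (VL i) (gverts (P, G))).
  { intros i Hi. apply in_gverts, in_or_app. left. apply tleaves_verts. now rewrite tleaves_l2t. }
  split; intros H Sw; destruct (H Sw) as [H1 H2]; (split; [| idtac]).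
  - now apply graph_forest, acyclic_forest.
  - intros u v Hu Hv. change u with (rep Sw P G (VL u)). change v with (rep Sw P G (VL v)).
    apply graph_conn_rep; auto.
  - intros u v Hu Hv. apply graph_conn; auto.
    destruct (graph_contraction Sw P G) as (T & K & _ & _ & _ & V & _).
    apply in_gverts in Hu, Hv. apply V in Hu as [_ Hu], Hv as [_ Hv].
    apply in_app_or in Hu, Hv. apply H2; [destruct Hu | destruct Hv]; auto.
  - now apply acyclic_forest, graph_forest.
Qed.

(** * Outcomes as an inductive relation, without switchings *)

(** A switching chooses independently at each node, so the possible pairs of a representative and an
    edge list are generated inductively. A tree can then be rearranged without transporting
    switchings along the changed addresses. *)
Inductive outcome : tr -> nat -> list (nat * nat) -> Prop :=
| out_leaf i : outcome (TLeaf i) i []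
| out_tens d b A B ra EA rb EB :
    outcome A ra EA -> outcome B rb EB ->
    outcome (TTens d A B) (if d b then rb else ra)
      ((if d b then (rb, ra) else (ra, rb)) :: EA ++ EB)
| out_par (b : bool) A B ra EA rb EB :
    outcome A ra EA -> outcome B rb EB ->
    outcome (TPar A B) (if b then rb else ra) (EA ++ EB).

Inductive seq_outcome : sequent -> list (nat * nat) -> Prop :=
| sout_nil : seq_outcome [] []
| sout_cons e G r E F :
    outcome (e2t e) r E -> seq_outcome G F -> seq_outcome (e :: G) (E ++ F).

Lemma outcome_switch s t : outcome t (trep s t) (tE s t).
Proof.
  revert s. induction t; intros s; simpl; [constructor | |].
  - now apply out_tens.
  - now apply out_par.
Qed.

Lemma seq_outcome_switch sg G : seq_outcome G (sE sg G).
Proof.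
  revert sg. induction G; intros sg; simpl; econstructor; eauto using outcome_switch.
Qed.

Lemma outcome_inv t r E : outcome t r E -> exists s, r = trep s t /\ E = tE s t.
Proof.
  induction 1 as [i | d b A B ra EA rb EB _ [s1 [-> ->]] _ [s2 [-> ->]]
                    | b A B ra EA rb EB _ [s1 [-> ->]] _ [s2 [-> ->]]].
  - now exists (fun _ => true).
  - now exists (fun q => match q with [] => b | false :: q' => s1 q' | true :: q' => s2 q' end).
  - now exists (fun q => match q with [] => b | false :: q' => s1 q' | true :: q' => s2 q' end).
Qed.

Lemma seq_outcome_inv G F : seq_outcome G F -> exists sg, F = sE sg G.
Proof.
  induction 1 as [| e G r E F H _ [sg ->]]; [now exists (fun _ _ => true) |].
  apply outcome_inv in H as [s [_ ->]].
  now exists (fun n => match n with 0 => s | S k => sg k end).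
Qed.

Definition lout (P : linking) : nat -> list (nat * nat) -> Prop := outcome (l2t P).

Definition acorrect (P : linking) (G : sequent) : Prop :=
  forall r E F, lout P r E -> seq_outcome G F -> spans (leaf_of P) (E ++ F).

Lemma switching_correct_acorrect P G :
  (forall i, In i (map fst (sleaves G)) -> leaf_of P i) ->
  switching_correct (P, G) <-> acorrect P G.
Proof.
  intros HG. rewrite switching_correct_spans by auto. split.
  - intros H r E F HE HF. apply outcome_inv in HE as [s [_ ->]].
    apply seq_outcome_inv in HF as [sg ->].
    apply (H (fun v => match v with VL _ => true | VP q => s q | VG k q => sg k q end)).
  - intros H Sw. eapply H; [apply outcome_switch | apply seq_outcome_switch].
Qed.

Lemma proof_graph_acorrect P G :
  proof_graph (P, G) <->
  Permutation (lleaves P) (sleaves G) /\ NoDup (map fst (lleaves P))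
  /\ (forall A B, In (ECut A B) G -> is_dual A B) /\ acorrect P G.
Proof.
  unfold proof_graph. simpl.
  split; intros (H1 & H2 & H3 & H4); (split; [| split; [| split]]); auto;
    apply switching_correct_acorrect in H4; auto;
    unfold leaf_of; intros i; apply Permutation_in; symmetry; now apply Permutation_map.
Qed.

Lemma outcome_ends t r E :
  outcome t r E ->
  In r (tleaves t) /\ forall e, In e E -> In (fst e) (tleaves t) /\ In (snd e) (tleaves t).
Proof.
  induction 1 as [i | d b A B ra EA rb EB _ [HA1 HA2] _ [HB1 HB2]
                    | b A B ra EA rb EB _ [HA1 HA2] _ [HB1 HB2]]; simpl.
  - split; [now left | easy].
  - split; [destruct (d b); apply in_or_app; auto |].
    intros e [<- | He]; rewrite !in_app_iff.
    + destruct (d b); simpl; auto.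
    + apply in_app_or in He as [He | He]; [apply HA2 in He | apply HB2 in He]; tauto.
  - split; [destruct b; apply in_or_app; auto |].
    intros e He; rewrite !in_app_iff.
    apply in_app_or in He as [He | He]; [apply HA2 in He | apply HB2 in He]; tauto.
Qed.

Lemma lout_ends P r E :
  lout P r E -> leaf_of P r /\ forall e, In e E -> leaf_of P (fst e) /\ leaf_of P (snd e).
Proof. unfold leaf_of. rewrite <- tleaves_l2t. apply outcome_ends. Qed.

Lemma seq_outcome_ends G F :
  seq_outcome G F ->
  forall e, In e F -> In (fst e) (map fst (sleaves G)) /\ In (snd e) (map fst (sleaves G)).
Proof.
  unfold sleaves. induction 1 as [| e G r E F H _ IH]; simpl; [easy |].
  intros x Hx. rewrite map_app, !in_app_iff, <- !tleaves_e2t.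
  apply outcome_ends in H as [_ H]. apply in_app_or in Hx as [Hx | Hx];
    [apply H in Hx | apply IH in Hx]; tauto.
Qed.

Lemma seq_outcome_exists G : exists F, seq_outcome G F.
Proof. exists (sE (fun _ _ => true) G). apply seq_outcome_switch. Qed.

Lemma lout_exists P : exists r E, lout P r E.
Proof. exists (trep (fun _ => true) (l2t P)), (tE (fun _ => true) (l2t P)). apply outcome_switch. Qed.

Lemma lout_switch s P : lout P (trep s (l2t P)) (tE s (l2t P)).
Proof. apply outcome_switch. Qed.

Lemma lout_one i r E : lout (LOne i) r E <-> r = i /\ E = [].
Proof.
  split; [intros H; now inversion H | intros [-> ->]; constructor].
Qed.

Lemma outcome_ax i j r E :
  outcome (TTens (fun b => b) (TLeaf i) (TLeaf j)) r E
  <-> (r = i /\ E = [(i, j)]) \/ (r = j /\ E = [(j, i)]).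
Proof.
  split.
  - intros H. inversion H as [| d b A B ra EA rb EB HA HB |]; subst.
    inversion HA; inversion HB; subst. destruct b; auto.
  - intros [[-> ->] | [-> ->]].
    + apply (out_tens (fun b => b) false _ _ i [] j []); constructor.
    + apply (out_tens (fun b => b) true _ _ i [] j []); constructor.
Qed.

Lemma lout_axPN a i j r E :
  lout (LAxPN a i j) r E <-> (r = i /\ E = [(i, j)]) \/ (r = j /\ E = [(j, i)]).
Proof. apply outcome_ax. Qed.

Lemma lout_axNP a i j r E :
  lout (LAxNP a i j) r E <-> (r = i /\ E = [(i, j)]) \/ (r = j /\ E = [(j, i)]).
Proof. apply outcome_ax. Qed.

Lemma lout_botL i Q r E : lout (LBotL i Q) r E <-> exists E', lout Q r E' /\ E = (r, i) :: E'.
Proof.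
  split.
  - intros H. inversion H as [| d b A B ra EA rb EB HA HB |]; subst.
    inversion HA; subst. now exists EB.
  - intros (E' & H & ->). apply (out_tens (fun _ => true) true _ _ i [] r E'); auto. constructor.
Qed.

Lemma lout_botR i Q r E : lout (LBotR Q i) r E <-> exists E', lout Q r E' /\ E = (r, i) :: E'.
Proof.
  split.
  - intros H. inversion H as [| d b A B ra EA rb EB HA HB |]; subst.
    inversion HB; subst. exists EA. now rewrite app_nil_r.
  - intros (E' & H & ->). rewrite <- (app_nil_r E').
    apply (out_tens (fun _ => false) true _ _ r E' i []); auto. constructor.
Qed.

Lemma lout_par Q R r E :
  lout (LPar Q R) r E <->
  exists rQ EQ rR ER, lout Q rQ EQ /\ lout R rR ER /\ (r = rQ \/ r = rR) /\ E = EQ ++ ER.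
Proof.
  split.
  - intros H. inversion H as [| | b A B ra EA rb EB HA HB]; subst.
    exists ra, EA, rb, EB. repeat split; auto. destruct b; auto.
  - intros (rQ & EQ & rR & ER & HQ & HR & [-> | ->] & ->).
    + now apply (out_par false _ _ rQ EQ rR ER).
    + now apply (out_par true _ _ rQ EQ rR ER).
Qed.

#[local] Opaque lout.

(** * Linking contexts *)

Fixpoint ccomp (C D : lctx) : lctx :=
  match C with
  | Hole => D
  | CParL C R => CParL (ccomp C D) R
  | CParR Q C => CParR Q (ccomp C D)
  | CBotL i C => CBotL i (ccomp C D)
  | CBotR C i => CBotR (ccomp C D) i
  end.

Lemma plug_ccomp C D X : plug (ccomp C D) X = plug C (plug D X).
Proof. induction C; simpl; congruence. Qed.

Fixpoint cleaves (C : lctx) : list (nat * lit) :=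
  match C with
  | Hole => []
  | CParL C R => cleaves C ++ lleaves R
  | CParR Q C => lleaves Q ++ cleaves C
  | CBotL i C | CBotR C i => (i, Bot) :: cleaves C
  end.

Lemma lleaves_plug C X : Permutation (lleaves (plug C X)) (lleaves X ++ cleaves C).
Proof.
  induction C; simpl; rewrite ?IHC, ?app_nil_r; auto.
  - now rewrite app_assoc.
  - rewrite !app_assoc. apply Permutation_app_tail, Permutation_app_comm.
  - apply Permutation_middle.
  - rewrite <- app_assoc. apply Permutation_app_head. symmetry. apply Permutation_cons_append.
Qed.

Definition star (r : nat) (ks : list nat) : list (nat * nat) := map (fun k => (r, k)) ks.

(* ks are the ⊥s of the context attached to the root of the plugged linking, up
   is the root of the whole when a ⅋ above the hole is switched away from it. *)
Inductive ctx_outcome : lctx -> list nat -> option nat -> list (nat * nat) -> Prop :=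
| cout_hole : ctx_outcome Hole [] None []
| cout_parL C R ks up F r E u : ctx_outcome C ks up F -> lout R r E ->
    u = up \/ u = Some r -> ctx_outcome (CParL C R) ks u (F ++ E)
| cout_parR C Q ks up F r E u : ctx_outcome C ks up F -> lout Q r E ->
    u = up \/ u = Some r -> ctx_outcome (CParR Q C) ks u (F ++ E)
| cout_botL_here i C ks F : ctx_outcome C ks None F -> ctx_outcome (CBotL i C) (i :: ks) None F
| cout_botR_here i C ks F : ctx_outcome C ks None F -> ctx_outcome (CBotR C i) (i :: ks) None F
| cout_botL i C ks r F :
    ctx_outcome C ks (Some r) F -> ctx_outcome (CBotL i C) ks (Some r) ((r, i) :: F)
| cout_botR i C ks r F :
    ctx_outcome C ks (Some r) F -> ctx_outcome (CBotR C i) ks (Some r) ((r, i) :: F).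

Definition up_root (up : option nat) (r : nat) : nat :=
  match up with Some u => u | None => r end.

Lemma lout_plug_inv C X r E :
  lout (plug C X) r E -> exists rX EX ks up F,
    lout X rX EX /\ ctx_outcome C ks up F /\ r = up_root up rX
    /\ Permutation E (EX ++ star rX ks ++ F).
Proof.
  revert r E. induction C as [| C IH R | Q C IH | i C IH | C IH i]; simpl; intros r E H.
  - exists r, E, [], None, []. rewrite app_nil_r. repeat split; auto. constructor.
  - apply lout_par in H as (r1 & E1 & r2 & E2 & H1 & H2 & Hr & ->).
    apply IH in H1 as (rX & EX & ks & up & F & HX & HC & -> & HP).
    assert (P : Permutation (E1 ++ E2) (EX ++ star rX ks ++ F ++ E2))
      by (rewrite HP; now rewrite <- !app_assoc).
    destruct Hr as [-> | ->]; [exists rX, EX, ks, up, (F ++ E2) | exists rX, EX, ks, (Some r2), (F ++ E2)];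
      repeat split; auto; econstructor; eauto.
  - apply lout_par in H as (r1 & E1 & r2 & E2 & H1 & H2 & Hr & ->).
    apply IH in H2 as (rX & EX & ks & up & F & HX & HC & -> & HP).
    assert (P : Permutation (E1 ++ E2) (EX ++ star rX ks ++ F ++ E1))
      by (rewrite HP, Permutation_app_comm; now rewrite <- !app_assoc).
    destruct Hr as [-> | ->]; [exists rX, EX, ks, (Some r1), (F ++ E1) | exists rX, EX, ks, up, (F ++ E1)];
      repeat split; auto; econstructor; eauto.
  - apply lout_botL in H as (E' & H & ->).
    apply IH in H as (rX & EX & ks & [u |] & F & HX & HC & -> & HP); simpl.
    + exists rX, EX, ks, (Some u), ((u, i) :: F). repeat split; auto; [now constructor |].
      rewrite HP, !app_assoc. apply Permutation_middle.
    + exists rX, EX, (i :: ks), None, F. repeat split; auto; [now constructor |].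
      rewrite HP. simpl. apply Permutation_middle.
  - apply lout_botR in H as (E' & H & ->).
    apply IH in H as (rX & EX & ks & [u |] & F & HX & HC & -> & HP); simpl.
    + exists rX, EX, ks, (Some u), ((u, i) :: F). repeat split; auto; [now constructor |].
      rewrite HP, !app_assoc. apply Permutation_middle.
    + exists rX, EX, (i :: ks), None, F. repeat split; auto; [now constructor |].
      rewrite HP. simpl. apply Permutation_middle.
Qed.

Lemma lout_plug C X rX EX ks up F :
  lout X rX EX -> ctx_outcome C ks up F ->
  exists E, lout (plug C X) (up_root up rX) E /\ Permutation E (EX ++ star rX ks ++ F).
Proof.
  intros HX HC. induction HC as
    [| C R ks up F r E u HC (E' & IH & HP) HR Hu | C R ks up F r E u HC (E' & IH & HP) HR Hu
     | i C ks F HC (E' & IH & HP) | i C ks F HC (E' & IH & HP)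
     | i C ks r F HC (E' & IH & HP) | i C ks r F HC (E' & IH & HP)]; simpl in *.
  - exists EX. simpl. now rewrite app_nil_r.
  - exists (E' ++ E). split.
    + apply lout_par. exists (up_root up rX), E', r, E. repeat split; auto.
      destruct Hu as [-> | ->]; auto.
    + rewrite HP. now rewrite <- !app_assoc.
  - exists (E ++ E'). split.
    + apply lout_par. exists r, E, (up_root up rX), E'. repeat split; auto.
      destruct Hu as [-> | ->]; auto.
    + rewrite HP, Permutation_app_comm. now rewrite <- !app_assoc.
  - exists ((rX, i) :: E'). split; [apply lout_botL; eauto |]. rewrite HP. apply Permutation_middle.
  - exists ((rX, i) :: E'). split; [apply lout_botR; eauto |]. rewrite HP. apply Permutation_middle.
  - exists ((r, i) :: E'). split; [apply lout_botL; eauto |].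
    rewrite HP, !app_assoc. apply Permutation_middle.
  - exists ((r, i) :: E'). split; [apply lout_botR; eauto |].
    rewrite HP, !app_assoc. apply Permutation_middle.
Qed.

Lemma ctx_outcome_ends C ks up F :
  ctx_outcome C ks up F ->
  (forall k, In k ks -> In k (map fst (cleaves C)))
  /\ (forall u, up = Some u -> In u (map fst (cleaves C)))
  /\ (forall e, In e F -> In (fst e) (map fst (cleaves C)) /\ In (snd e) (map fst (cleaves C))).
Proof.
  induction 1 as [| C R ks up F r E u HC (IH1 & IH2 & IH3) HR Hu | C R ks up F r E u HC (IH1 & IH2 & IH3) HR Hu
     | i C ks F HC (IH1 & IH2 & IH3) | i C ks F HC (IH1 & IH2 & IH3)
     | i C ks r F HC (IH1 & IH2 & IH3) | i C ks r F HC (IH1 & IH2 & IH3)]; simpl.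
  - easy.
  - apply lout_ends in HR as [HR1 HR2]. rewrite map_app.
    split; [| split]; intros x Hx; rewrite !in_app_iff.
    + auto.
    + destruct Hu as [-> | ->]; [auto |]. injection Hx as <-. auto.
    + apply in_app_or in Hx as [Hx | Hx]; [apply IH3 in Hx | apply HR2 in Hx]; tauto.
  - apply lout_ends in HR as [HR1 HR2]. rewrite map_app.
    split; [| split]; intros x Hx; rewrite !in_app_iff.
    + auto.
    + destruct Hu as [-> | ->]; [auto |]. injection Hx as <-. auto.
    + apply in_app_or in Hx as [Hx | Hx]; [apply IH3 in Hx | apply HR2 in Hx]; tauto.
  - split; [| split]; [intros k [-> | Hk]; auto | easy | intros e He; apply IH3 in He; tauto].
  - split; [| split]; [intros k [-> | Hk]; auto | easy | intros e He; apply IH3 in He; tauto].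
  - split; [| split]; [auto | intros u Hu; right; auto |].
    intros e [<- | He]; [simpl; auto | apply IH3 in He; tauto].
  - split; [| split]; [auto | intros u Hu; right; auto |].
    intros e [<- | He]; [simpl; auto | apply IH3 in He; tauto].
Qed.

Definition env (C : lctx) (G : sequent) (ks : list nat) (Z : list (nat * nat)) : Prop :=
  exists up F0 F, ctx_outcome C ks up F0 /\ seq_outcome G F /\ Z = F0 ++ F.

(** Everything outside the hole is summarised by [ks] and [Z], which do not depend on [X]. Two
    linkings can thus be compared in one and the same environment; the root of the whole linking no
    longer matters. *)
Lemma acorrect_plug C X G :
  acorrect (plug C X) G <->
  forall r E ks Z, lout X r E -> env C G ks Z ->
    spans (leaf_of (plug C X)) (E ++ star r ks ++ Z).
Proof.
  split.
  - intros H r E ks Z HX (up & F0 & F & HC & HF & ->).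
    destruct (lout_plug _ _ _ _ _ _ _ HX HC) as (E' & HE & HP).
    apply spans_perm with (E' ++ F); [| eapply H; eauto].
    rewrite HP. now rewrite <- !app_assoc.
  - intros H r E F HE HF. apply lout_plug_inv in HE as (rX & EX & ks & up & F0 & HX & HC & _ & HP).
    apply spans_perm with (EX ++ star rX ks ++ F0 ++ F).
    + rewrite HP. now rewrite <- !app_assoc.
    + apply H; auto. exists up, F0, F. auto.
Qed.

Lemma env_exists C G : exists ks Z, env C G ks Z.
Proof.
  (* The filler [LOne 0] is arbitrary: only the part of the outcome that belongs to the context is
     kept. *)
  destruct (seq_outcome_exists G) as [F HF]. destruct (lout_exists (plug C (LOne 0))) as (r & E & H).
  apply lout_plug_inv in H as (_ & _ & ks & up & F0 & _ & HC & _). exists ks, (F0 ++ F), up, F0, F. auto.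
Qed.

Lemma leaf_of_plug C X i :
  leaf_of (plug C X) i <-> leaf_of X i \/ In i (map fst (cleaves C)).
Proof.
  unfold leaf_of. rewrite <- in_app_iff, <- map_app.
  split; apply Permutation_in, Permutation_map; [| symmetry]; apply lleaves_plug.
Qed.

(** * Structural moves of linkings *)

(** These moves preserve the set of outcomes up to the order of edges, in any context and for any
    sequent, so they need no correctness argument of their own. *)
Inductive lmove : linking -> linking -> Prop :=
| lm_par_comm C Q R : lmove (plug C (LPar Q R)) (plug C (LPar R Q))
| lm_par_assoc C Q R T : lmove (plug C (LPar Q (LPar R T))) (plug C (LPar (LPar Q R) T))
| lm_ax_comm C a i j : lmove (plug C (LAxPN a i j)) (plug C (LAxNP a j i))
| lm_bot_comm C i Q : lmove (plug C (LBotL i Q)) (plug C (LBotR Q i)).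

Definition leq : linking -> linking -> Prop := clos_refl_sym_trans linking lmove.

Lemma lmove_simstep P P' G : lmove P P' -> simstep (P, G) (P', G).
Proof. destruct 1; constructor. Qed.

Lemma lmove_plug C P P' : lmove P P' -> lmove (plug C P) (plug C P').
Proof. destruct 1; rewrite <- !plug_ccomp; constructor. Qed.

Lemma leq_plug C P P' : leq P P' -> leq (plug C P) (plug C P').
Proof.
  induction 1; [now apply rst_step, lmove_plug | apply rst_refl | now apply rst_sym
                | eapply rst_trans; eauto].
Qed.

Definition subout (P P' : linking) : Prop :=
  forall r E, lout P r E -> exists E', lout P' r E' /\ Permutation E E'.

Lemma subout_plug C P P' : subout P P' -> subout (plug C P) (plug C P').
Proof.
  intros H r E HE. apply lout_plug_inv in HE as (rX & EX & ks & up & F & HX & HC & -> & HP).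
  apply H in HX as (E' & HE' & HP'). destruct (lout_plug _ _ _ _ _ _ _ HE' HC) as (E'' & H1 & H2).
  exists E''. split; auto. now rewrite HP, HP', H2.
Qed.

Lemma lmove_subout P P' :
  lmove P P' -> Permutation (lleaves P) (lleaves P') /\ subout P P' /\ subout P' P.
Proof.
  assert (K : forall C X X', Permutation (lleaves X) (lleaves X') -> subout X X' -> subout X' X ->
    Permutation (lleaves (plug C X)) (lleaves (plug C X'))
    /\ subout (plug C X) (plug C X') /\ subout (plug C X') (plug C X)).
  { intros C X X' HP H1 H2. split; [| now split; apply subout_plug].
    rewrite !lleaves_plug. now apply Permutation_app_tail. }
  destruct 1; apply K; simpl.
  - apply Permutation_app_comm.
  - intros r E H. apply lout_par in H as (r1 & E1 & r2 & E2 & H1 & H2 & Hr & ->).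
    exists (E2 ++ E1). split; [| apply Permutation_app_comm]. apply lout_par.
    exists r2, E2, r1, E1. tauto.
  - intros r E H. apply lout_par in H as (r1 & E1 & r2 & E2 & H1 & H2 & Hr & ->).
    exists (E2 ++ E1). split; [| apply Permutation_app_comm]. apply lout_par.
    exists r2, E2, r1, E1. tauto.
  - now rewrite app_assoc.
  - intros r E H. apply lout_par in H as (r1 & E1 & r2 & E2 & H1 & H2 & Hr & ->).
    apply lout_par in H2 as (r3 & E3 & r4 & E4 & H3 & H4 & Hr' & ->).
    exists ((E1 ++ E3) ++ E4). split; [| now rewrite app_assoc]. apply lout_par.
    destruct Hr as [-> | ->]; [exists r1, (E1 ++ E3), r4, E4 | exists r3, (E1 ++ E3), r4, E4];
      repeat split; auto; apply lout_par; exists r1, E1, r3, E3; auto.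
  - intros r E H. apply lout_par in H as (r1 & E1 & r2 & E2 & H1 & H2 & Hr & ->).
    apply lout_par in H1 as (r3 & E3 & r4 & E4 & H3 & H4 & Hr' & ->).
    exists (E3 ++ E4 ++ E2). split; [| now rewrite app_assoc]. apply lout_par.
    destruct Hr as [-> | ->]; [exists r3, E3, r4, (E4 ++ E2) | exists r3, E3, r2, (E4 ++ E2)];
      repeat split; auto; apply lout_par; exists r4, E4, r2, E2; auto.
  - apply perm_swap.
  - intros r E H. exists E. split; auto. apply lout_axPN in H. apply lout_axNP. tauto.
  - intros r E H. exists E. split; auto. apply lout_axNP in H. apply lout_axPN. tauto.
  - apply Permutation_cons_append.
  - intros r E H. exists E. split; auto. apply lout_botR. now apply lout_botL.
  - intros r E H. exists E. split; auto. apply lout_botL. now apply lout_botR.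
Qed.

Lemma spans_leaf_perm P P' E :
  Permutation (lleaves P) (lleaves P') -> spans (leaf_of P) E -> spans (leaf_of P') E.
Proof.
  intros HP [H1 H2]. split; auto. unfold leaf_of in *.
  intros u v Hu Hv. apply H2; [revert Hu | revert Hv]; apply Permutation_in; symmetry;
    now apply Permutation_map.
Qed.

Lemma proof_graph_subout P P' G :
  Permutation (lleaves P) (lleaves P') -> subout P' P ->
  proof_graph (P, G) -> proof_graph (P', G).
Proof.
  intros HP HS. rewrite !proof_graph_acorrect. intros (H1 & H2 & H3 & H4). split; [| split; [| split]]; auto.
  - now rewrite <- HP.
  - now rewrite <- HP.
  - intros r E F HE HF. apply HS in HE as (E' & HE & HQ). apply (spans_leaf_perm P); auto.
    apply spans_perm with (E' ++ F); [now rewrite HQ | eauto].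
Qed.

(** Correctness is carried along in both directions because [leq] may use moves backwards while
    [sim] demands a proof graph at every stage. *)
Lemma leq_sim P P' G :
  leq P P' -> (proof_graph (P, G) <-> proof_graph (P', G))
              /\ (proof_graph (P, G) -> sim (P, G) (P', G)).
Proof.
  induction 1 as [P P' H | P | P P' _ [IH1 IH2] | P P' P'' _ [IH1 IH2] _ [IH3 IH4]].
  - assert (HS := lmove_subout _ _ H). destruct HS as (HP & S1 & S2).
    assert (K : proof_graph (P, G) <-> proof_graph (P', G))
      by (split; apply proof_graph_subout; auto; now symmetry).
    split; auto. intros X. apply rst_step. split; [| split]; [auto | now apply K | now apply lmove_simstep].
  - split; [tauto | intros _; apply rst_refl].
  - split; [tauto |]. intros X. apply rst_sym. tauto.
  - split; [tauto |]. intros X. apply rst_trans with (P', G); tauto.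
Qed.

(** * Moving a ⊥ across a ⅋ *)

(** A path either uses an edge of the star, and then meets its centre, or avoids the star
    altogether. In the second case it persists when a change of switching moves the centre. *)
Lemma conn_star r ks E u v :
  conn (star r ks ++ E) u v -> conn (star r ks ++ E) u r \/ conn E u v.
Proof.
  induction 1 as [x y H | x | x y H IH | x y z _ IH1 H2 IH2]; auto.
  - apply in_app_or in H as [H | H]; [| auto].
    apply in_map_iff in H as (k & H & Hk). injection H as <- <-. auto.
  - destruct IH as [IH | IH]; [left | right; now apply conn_sym].
    apply conn_trans with x; auto. now apply conn_sym.
  - destruct IH1 as [IH1 | IH1]; auto. destruct IH2 as [IH2 | IH2]; [left | right; eauto using conn_trans].
    apply conn_trans with y; auto. revert IH1. apply conn_mono, incl_appr, incl_refl.
Qed.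

Lemma conn_incl_app {V} (E1 E2 F1 F2 : list (V * V)) u v :
  incl E1 F1 -> incl E2 F2 -> conn (E1 ++ E2) u v -> conn (F1 ++ F2) u v.
Proof. intros H1 H2. apply conn_mono, incl_app_app; auto. Qed.

(* The ⅋s between a leaf q and the root of P can be switched towards q. *)
Lemma lout_reach P r E F i q :
  lout P r E -> leaf_of P q -> conn (E ++ F) i q ->
  exists r' E', lout P r' E' /\ conn (E' ++ F) i r'.
Proof.
  revert r E F. induction P as [j | a j k | a j k | k P IH | P IH k | P IHP Q IHQ];
    intros r E F H Hq HC; unfold leaf_of in Hq; simpl in Hq.
  - exists r, E. split; auto. apply lout_one in H as [-> ->]. destruct Hq as [-> | []]. auto.
  - exists r, E. split; auto. apply lout_axPN in H as [[-> ->] | [-> ->]];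
      destruct Hq as [-> | [-> | []]]; auto; simpl in *;
      (eapply conn_trans; [apply HC |]);
      (apply conn_edge; now left) || (apply conn_sym, conn_edge; now left).
  - exists r, E. split; auto. apply lout_axNP in H as [[-> ->] | [-> ->]];
      destruct Hq as [-> | [-> | []]]; auto; simpl in *;
      (eapply conn_trans; [apply HC |]);
      (apply conn_edge; now left) || (apply conn_sym, conn_edge; now left).
  - assert (H' := H). apply lout_botL in H' as (E' & H' & ->).
    (* The edge of the ⊥ is a star with one ray, whose centre moves when the premise is switched
       differently. *)
    change (((r, k) :: E') ++ F) with (star r [k] ++ (E' ++ F)) in HC.
    destruct Hq as [<- | Hq].
    + exists r, ((r, k) :: E'). split; auto. eapply conn_trans; [apply HC |].
      apply conn_sym, conn_edge. now left.
    + apply conn_star in HC as [HC | HC]; [eauto |].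
      destruct (IH _ _ _ H' Hq HC) as (r' & E'' & H1 & H2).
      exists r', ((r', k) :: E''). split; [apply lout_botL; eauto |].
      revert H2. apply conn_mono. intros x Hx. now right.
  - assert (H' := H). apply lout_botR in H' as (E' & H' & ->).
    change (((r, k) :: E') ++ F) with (star r [k] ++ (E' ++ F)) in HC.
    rewrite map_app in Hq. apply in_app_or in Hq as [Hq | [<- | []]].
    + apply conn_star in HC as [HC | HC]; [eauto |].
      destruct (IH _ _ _ H' Hq HC) as (r' & E'' & H1 & H2).
      exists r', ((r', k) :: E''). split; [apply lout_botR; eauto |].
      revert H2. apply conn_mono. intros x Hx. now right.
    + exists r, ((r, k) :: E'). split; auto. eapply conn_trans; [apply HC |].
      apply conn_sym, conn_edge. now left.
  - apply lout_par in H as (r1 & E1 & r2 & E2 & H1 & H2 & _ & ->).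
    rewrite map_app in Hq. apply in_app_or in Hq as [Hq | Hq].
    + rewrite <- app_assoc in HC. destruct (IHP _ _ _ H1 Hq HC) as (r' & E' & K1 & K2).
      exists r', (E' ++ E2). rewrite <- app_assoc. split; auto.
      apply lout_par. exists r', E', r2, E2. auto.
    + assert (HC' : conn (E2 ++ E1 ++ F) i q)
        by (revert HC; apply conn_perm; rewrite !app_assoc; apply Permutation_app_tail, Permutation_app_comm).
      destruct (IHQ _ _ _ H2 Hq HC') as (r' & E' & K1 & K2).
      exists r', (E1 ++ E'). split.
      * apply lout_par. exists r1, E1, r', E'. auto.
      * revert K2. apply conn_perm. rewrite !app_assoc. apply Permutation_app_tail, Permutation_app_comm.
Qed.

(* Otherwise the connection could be prolonged inside X to the node X ⊗ ⊥_i, closing a cycle. *)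
Lemma bot_separated C X i G r E ks Z q :
  acorrect (plug C (LBotR X i)) G -> lout X r E -> env C G ks Z -> leaf_of X q ->
  ~ conn (E ++ star r ks ++ Z) i q.
Proof.
  rewrite acorrect_plug. intros HA HX HZ Hq HC.
  assert (HN : forall r' E', lout X r' E' -> ~ conn (E' ++ star r' ks ++ Z) i r').
  { intros r' E' H' HC'.
    assert (HB : lout (LBotR X i) r' ((r', i) :: E')) by (apply lout_botR; eauto).
    destruct (HA _ _ _ _ HB HZ) as [[HF _] _]. simpl in HF. now apply HF, conn_sym. }
  assert (HC' : conn (star r ks ++ (E ++ Z)) i q).
  { revert HC. apply conn_perm. rewrite !app_assoc. apply Permutation_app_tail, Permutation_app_comm. }
  apply conn_star in HC' as [HC' | HC'].
  - apply (HN _ _ HX). revert HC'. apply conn_perm. rewrite !app_assoc.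
    apply Permutation_app_tail, Permutation_app_comm.
  - destruct (lout_reach _ _ _ _ _ _ HX Hq HC') as (r' & E' & H1 & H2).
    apply (HN _ _ H1). revert H2. apply conn_incl_app; auto using incl_refl, incl_appr.
Qed.

Lemma lleaves_par_bot Q R i :
  Permutation (lleaves (LPar Q (LBotR R i))) (lleaves (LBotR (LPar Q R) i)).
Proof. simpl. now rewrite app_assoc. Qed.

(** On leaves the move shifts one end of the edge of ⊥_i from [r] to [rR]. By [spans_move] this is
    allowed if [i] and [rR] are apart once the edge is removed, and [bot_separated], applied to Q ⅋
    R, gives this for every leaf of Q ⅋ R. *)
Lemma par_bot_up_correct C Q R i G :
  acorrect (plug C (LBotR (LPar Q R) i)) G -> acorrect (plug C (LPar Q (LBotR R i))) G.
Proof.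
  intros HA. assert (HA' := HA). rewrite acorrect_plug in HA'. apply acorrect_plug.
  assert (HL : Permutation (lleaves (plug C (LBotR (LPar Q R) i))) (lleaves (plug C (LPar Q (LBotR R i)))))
    by (rewrite !lleaves_plug; apply Permutation_app_tail; symmetry; apply lleaves_par_bot).
  intros r E ks Z HX HZ. apply (spans_leaf_perm _ _ _ HL).
  apply lout_par in HX as (rQ & EQ & rR & ER & HQ & HR & Hr & ->).
  apply lout_botR in HR as (ER' & HR & ->).
  assert (HX : lout (LPar Q R) r (EQ ++ ER')) by (apply lout_par; exists rQ, EQ, rR, ER'; auto).
  assert (HB : lout (LBotR (LPar Q R) i) r ((r, i) :: EQ ++ ER')) by (apply lout_botR; eauto).
  assert (HS := HA' _ _ _ _ HB HZ).
  apply spans_perm with ((rR, i) :: (EQ ++ ER') ++ star r ks ++ Z).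
  { rewrite <- !app_assoc. apply Permutation_middle. }
  simpl in HS. apply lout_ends in HQ as [LQ _], HR as [LR _].
  assert (LX : forall q, leaf_of Q q \/ leaf_of R q -> leaf_of (LPar Q R) q)
    by (unfold leaf_of; simpl; intros q; rewrite map_app; apply in_or_app).
  assert (LP : forall q, leaf_of (LPar Q R) q \/ q = i -> leaf_of (plug C (LBotR (LPar Q R) i)) q).
  { intros q Hq. apply leaf_of_plug. left. unfold leaf_of in *. simpl in *.
    rewrite map_app, in_app_iff. simpl. destruct Hq as [Hq | ->]; auto. }
  apply spans_move with r; auto.
  - apply LP. left. apply LX. destruct Hr as [-> | ->]; auto.
  - eapply bot_separated; eauto.
Qed.

(** The edge of ⊥_i moves from [rR] to [r]. The two differ in origin only if the ⅋ is switched to Q,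
    so separation from the leaves of Q is enough. *)
Lemma par_bot_down_correct C Q R i G :
  acorrect (plug C (LPar Q (LBotR R i))) G ->
  (forall r E ks Z q, lout (LPar Q R) r E -> env C G ks Z -> leaf_of Q q ->
     ~ conn (E ++ star r ks ++ Z) i q) ->
  acorrect (plug C (LBotR (LPar Q R) i)) G.
Proof.
  intros HA HS. rewrite acorrect_plug in HA. apply acorrect_plug.
  assert (HL : Permutation (lleaves (plug C (LPar Q (LBotR R i)))) (lleaves (plug C (LBotR (LPar Q R) i))))
    by (rewrite !lleaves_plug; apply Permutation_app_tail; apply lleaves_par_bot).
  intros r E ks Z HX HZ. apply (spans_leaf_perm _ _ _ HL).
  apply lout_botR in HX as (E' & HX & ->). assert (HX' := HX).
  apply lout_par in HX' as (rQ & EQ & rR & ER & HQ & HR & Hr & ->).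
  assert (HB : lout (LPar Q (LBotR R i)) r (EQ ++ (rR, i) :: ER)).
  { apply lout_par. exists rQ, EQ, rR, ((rR, i) :: ER). repeat split; auto. apply lout_botR. eauto. }
  assert (HT := HA _ _ _ _ HB HZ).
  assert (HT' : spans (leaf_of (plug C (LPar Q (LBotR R i)))) ((rR, i) :: (EQ ++ ER) ++ star r ks ++ Z)).
  { revert HT. apply spans_perm. rewrite <- !app_assoc. symmetry. apply Permutation_middle. }
  simpl. destruct Hr as [-> | ->]; [| exact HT'].
  apply lout_ends in HQ as [LQ _], HR as [LR _].
  apply spans_move with rR; eauto; try (apply leaf_of_plug; left; unfold leaf_of in *; simpl;
    rewrite !map_app, !in_app_iff; simpl; auto).
Qed.

(** Changing the content of the hole leaves all addresses of the context alone. [J] is the one edge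
    allowed to disappear: the edge from ⊥_i to its parent when the leaf is renamed. *)
Lemma in_ledges_plug J C X X' p e :
  (forall p, lnode p X = lnode p X') ->
  (In e (ledges (p ++ caddr C) X) -> e = J \/ In e (ledges (p ++ caddr C) X')) ->
  In e (ledges p (plug C X)) -> e = J \/ In e (ledges p (plug C X')).
Proof.
  intros HX. assert (HN : forall C p, lnode p (plug C X) = lnode p (plug C X')) by (intros []; auto).
  revert p. induction C as [| C IH T | T C IH | k C IH | C IH k]; intros p; simpl.
  - now rewrite app_nil_r.
  - intros H. rewrite (HN C). rewrite !in_app_iff. specialize (IH (p ++ [false])).
    rewrite <- app_assoc in IH. tauto.
  - intros H. rewrite (HN C). rewrite !in_app_iff. specialize (IH (p ++ [true])).
    rewrite <- app_assoc in IH. tauto.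
  - intros H. rewrite (HN C). specialize (IH (p ++ [true])). rewrite <- app_assoc in IH. tauto.
  - intros H. rewrite (HN C). specialize (IH (p ++ [false])). rewrite <- app_assoc in IH. tauto.
Qed.

Lemma tsub_plug_par C Q R q :
  tsub (caddr C ++ false :: q) (l2t (plug C (LPar Q R))) = tsub q (l2t Q).
Proof. induction C; simpl; auto. Qed.

Lemma fresh_nat (l : list nat) : exists n, ~ In n l.
Proof.
  exists (S (list_max l)). intros H.
  assert (K := proj1 (list_max_le l _) (Nat.le_refl _)). rewrite Forall_forall in K.
  apply K in H. lia.
Qed.

(* To delete the edge to ⊥_i we redirect it to a leaf i' occurring nowhere else. *)
Lemma par_bot_side_outcome C Q R i G :
  (forall r E ks Z q, lout (LPar Q R) r E -> env C G ks Z -> leaf_of Q q ->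
     ~ conn (E ++ star r ks ++ Z) i q) ->
  par_bot_side C Q R i G.
Proof.
  intros H s v Hv HC.
  destruct (fresh_nat (i :: map fst (lleaves (plug C (LPar Q R))) ++ map fst (sleaves G))) as [i' Hi'].
  simpl in Hi'. rewrite in_app_iff in Hi'. fold (leaf_of (plug C (LPar Q R)) i') in Hi'.
  rewrite leaf_of_plug in Hi'.
  assert (HC' : connected_in (gedges (plug C (LPar Q (LBotR R i')), G)) (kept s) v (VL i)).
  { clear Hv. induction HC as [x y (e & He & [Hk Hne] & Hs & Hd) | x | x y _ IH | x y z _ IH1 _ IH2].
    - apply rst_step. exists e. repeat split; auto. unfold gedges in *. simpl in *.
      apply in_or_app. apply in_app_or in He as [He | He]; [left | now right].
      eapply (in_ledges_plug (Edge (VP (caddr C ++ [true])) (VL i) None)) in He as [He | He];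
        [contradiction | exact He | reflexivity |].
      simpl. rewrite !in_app_iff. simpl. intuition auto.
    - apply rst_refl.
    - now apply rst_sym.
    - now apply rst_trans with y. }
  apply graph_conn_rep in HC'. unfold outE in HC'.
  assert (Hq : leaf_of Q (rep s (plug C (LPar Q (LBotR R i'))) G v)).
  { unfold leaf_of. rewrite <- tleaves_l2t. apply in_lverts, tverts_inv in Hv
      as [(j & -> & Hj) | (q & u & -> & Hu)]; simpl; auto.
    rewrite <- app_assoc. simpl. rewrite tsub_plug_par, Hu. eapply tsub_leaves; eauto using trep_leaf. }
  change (rep s (plug C (LPar Q (LBotR R i'))) G (VL i)) with i in HC'.
  revert HC' Hq. generalize (rep s (plug C (LPar Q (LBotR R i'))) G v) as q.
  intros q HC' Hq.
  assert (HE := lout_switch (fun q => s (VP q)) (plug C (LPar Q (LBotR R i')))).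
  apply lout_plug_inv in HE as (r & E & ks & up & F0 & HX & HCx & _ & HP).
  assert (HF := seq_outcome_switch (fun k q => s (VG k q)) G).
  revert HC' HP HF. generalize (tE (fun q => s (VP q)) (l2t (plug C (LPar Q (LBotR R i'))))) as E1.
  generalize (sE (fun k q => s (VG k q)) G) as F. intros F E1 HC' HP HF.
  apply lout_par in HX as (rQ & EQ & rR & ER & HQ & HR & Hr & ->).
  apply lout_botR in HR as (ER' & HR & ->).
  set (Y := (EQ ++ ER') ++ star r ks ++ F0 ++ F).
  assert (HY : conn ((rR, i') :: Y) q i).
  { revert HC'. apply conn_perm. rewrite HP. unfold Y. rewrite <- !app_assoc. symmetry.
    apply Permutation_middle. }
  assert (HXE : lout (LPar Q R) r (EQ ++ ER')) by (apply lout_par; exists rQ, EQ, rR, ER'; auto).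
  assert (HZ : env C G ks (F0 ++ F)) by (exists up, F0, F; auto).
  assert (HI : forall x, conn Y i' x -> i' = x).
  { intros x. apply conn_isolated. intros e He. unfold Y in He.
    enough ((fst e = i' \/ snd e = i') -> False) by tauto. intros Hx. apply Hi'. right.
    apply in_app_or in He as [He | He]; [| apply in_app_or in He as [He | He];
      [| apply in_app_or in He as [He | He]]].
    - apply lout_ends in HXE as [_ HXE]. apply HXE in He. destruct Hx; subst; tauto.
    - apply lout_ends in HXE as [HXE _]. apply in_map_iff in He as (k & <- & Hk).
      apply ctx_outcome_ends in HCx as [HCx _]. apply HCx in Hk. simpl in Hx.
      destruct Hx; subst; tauto.
    - apply ctx_outcome_ends in HCx as (_ & _ & HCx). apply HCx in He. destruct Hx; subst; tauto.
    - eapply seq_outcome_ends in HF; [| exact He]. destruct Hx; subst; tauto. }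
  (* A use of the redirected edge would make [i'] equal to [i] or to the leaf [q] of Q. *)
  apply conn_cons in HY as [HY | [[_ HY] | [HY _]]].
  - apply conn_sym in HY. revert HY. now apply H.
  - apply HI in HY. subst. tauto.
  - apply conn_sym, HI in HY. subst. unfold leaf_of in *. simpl in Hi'.
    rewrite map_app, in_app_iff in Hi'. tauto.
Qed.

Lemma proof_graph_leaves_perm P P' G :
  Permutation (lleaves P) (lleaves P') -> acorrect P' G ->
  proof_graph (P, G) -> proof_graph (P', G).
Proof.
  intros HP HA. rewrite !proof_graph_acorrect. intros (H1 & H2 & H3 & _).
  rewrite <- HP. auto.
Qed.

(** [bot_separated] serves twice: for the correctness of the new graph and for the side condition of
    the step, which is read in that new graph. *)
Lemma par_bot_up C Q R i G :
  proof_graph (plug C (LBotR (LPar Q R) i), G) ->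
  proof_graph (plug C (LPar Q (LBotR R i)), G)
  /\ sim (plug C (LBotR (LPar Q R) i), G) (plug C (LPar Q (LBotR R i)), G).
Proof.
  intros HG. assert (HA : acorrect (plug C (LBotR (LPar Q R) i)) G)
    by now apply proof_graph_acorrect in HG.
  assert (HG' : proof_graph (plug C (LPar Q (LBotR R i)), G)).
  { revert HG. apply proof_graph_leaves_perm; [| now apply par_bot_up_correct].
    rewrite !lleaves_plug. apply Permutation_app_tail. symmetry. apply lleaves_par_bot. }
  split; auto. apply rst_sym, rst_step. split; [| split]; auto. constructor.
  apply par_bot_side_outcome. intros r E ks Z q HX HZ Hq.
  eapply bot_separated; eauto. unfold leaf_of in *. simpl. rewrite map_app. apply in_or_app. auto.
Qed.

Lemma par_bot_down C Q R i G :
  proof_graph (plug C (LPar Q (LBotR R i)), G) ->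
  (forall r E ks Z q, lout (LPar Q R) r E -> env C G ks Z -> leaf_of Q q ->
     ~ conn (E ++ star r ks ++ Z) i q) ->
  proof_graph (plug C (LBotR (LPar Q R) i), G)
  /\ sim (plug C (LPar Q (LBotR R i)), G) (plug C (LBotR (LPar Q R) i), G).
Proof.
  intros HG HS. assert (HA : acorrect (plug C (LPar Q (LBotR R i))) G)
    by now apply proof_graph_acorrect in HG.
  assert (HG' : proof_graph (plug C (LBotR (LPar Q R) i), G)).
  { revert HG. apply proof_graph_leaves_perm; [| now apply par_bot_down_correct].
    rewrite !lleaves_plug. apply Permutation_app_tail. apply lleaves_par_bot. }
  split; auto. apply rst_step. split; [| split]; auto. constructor.
  now apply par_bot_side_outcome.
Qed.

(** * Bringing the two cut leaves together *)

(** The path between a node and a link above it, listed from the node upwards: [inl R] is a ⅋ with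
    side premise [R], [inr k] a ⊗ with ⊥_k. Commutativity puts the link's side always to the right
    of a ⅋ and to the left of a ⊥. *)
Fixpoint spine (l : list (linking + nat)) : lctx :=
  match l with
  | [] => Hole
  | inl R :: l' => CParR R (spine l')
  | inr k :: l' => CBotR (spine l') k
  end.

Lemma spine_app l1 l2 : spine (l1 ++ l2) = ccomp (spine l1) (spine l2).
Proof. induction l1 as [| [R | k] l IH]; simpl; congruence. Qed.

Definition reaches (P X : linking) : Prop := exists l, leq P (plug (spine l) X).

Lemma reaches_plug P X : reaches P X -> forall P' x, leq P' (plug (spine [x]) P) -> reaches P' X.
Proof.
  intros [l H] P' x H'. exists (x :: l). eapply rst_trans; [exact H' |].
  change (x :: l) with ([x] ++ l). rewrite spine_app, plug_ccomp. now apply leq_plug.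
Qed.

Lemma reaches_refl P P' : leq P P' -> reaches P P'.
Proof. now exists []. Qed.

Lemma leq_par_comm Q R : leq (LPar Q R) (LPar R Q).
Proof. apply rst_step, (lm_par_comm Hole). Qed.

Lemma leq_par_assoc Q R T : leq (LPar Q (LPar R T)) (LPar (LPar Q R) T).
Proof. apply rst_step, (lm_par_assoc Hole). Qed.

Lemma leq_ax_comm a i j : leq (LAxPN a i j) (LAxNP a j i).
Proof. apply rst_step, (lm_ax_comm Hole). Qed.

Lemma leq_bot_comm i Q : leq (LBotL i Q) (LBotR Q i).
Proof. apply rst_step, (lm_bot_comm Hole). Qed.

Lemma leq_refl P : leq P P.
Proof. apply rst_refl. Qed.

Lemma reaches_parL Q R X : reaches Q X -> reaches (LPar Q R) X.
Proof. intros H. apply (reaches_plug _ _ H _ (inl R)), leq_par_comm. Qed.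

Lemma reaches_parR Q R X : reaches R X -> reaches (LPar Q R) X.
Proof. intros H. apply (reaches_plug _ _ H _ (inl Q)), leq_refl. Qed.

Lemma reaches_botL i Q X : reaches Q X -> reaches (LBotL i Q) X.
Proof. intros H. apply (reaches_plug _ _ H _ (inr i)), leq_bot_comm. Qed.

Lemma reaches_botR i Q X : reaches Q X -> reaches (LBotR Q i) X.
Proof. intros H. apply (reaches_plug _ _ H _ (inr i)), leq_refl. Qed.

#[local] Hint Resolve reaches_parL reaches_parR reaches_botL reaches_botR : core.

(* link x X: X is the innermost linking containing the leaf x, in the form in
   which the reduction rules of cuts expect it. *)
Inductive link : nat * lit -> linking -> Prop :=
| link_pos a h i : link (i, Pos a) (LAxNP a h i)
| link_neg a j k : link (j, Neg a) (LAxNP a j k)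
| link_bot Q i : link (i, Bot) (LBotR Q i)
| link_one j : link (j, One) (LOne j).
#[local] Hint Constructors link : core.

Lemma link_reached x P : In x (lleaves P) -> exists X, link x X /\ reaches P X.
Proof.
  induction P as [j | a j k | a j k | k P IH | P IH k | P IHP Q IHQ]; simpl.
  - intros [<- | []]. exists (LOne j). split; auto. apply reaches_refl, leq_refl.
  - intros H. exists (LAxNP a k j). split; [destruct H as [<- | [<- | []]]; auto |].
    apply reaches_refl, leq_ax_comm.
  - intros H. exists (LAxNP a j k). split; [destruct H as [<- | [<- | []]]; auto |].
    apply reaches_refl, leq_refl.
  - intros [<- | H].
    + exists (LBotR P k). split; auto. apply reaches_refl, leq_bot_comm.
    + apply IH in H as (X & H1 & H2). eauto.
  - intros H. apply in_app_or in H as [H | [<- | []]].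
    + apply IH in H as (X & H1 & H2). eauto.
    + exists (LBotR P k). split; auto. apply reaches_refl, leq_refl.
  - intros H. apply in_app_or in H as [H | H];
      [apply IHP in H as (X & H1 & H2) | apply IHQ in H as (X & H1 & H2)]; eauto.
Qed.

Definition joined (x y : nat * lit) (P : linking) : Prop :=
  exists C l1 L1 l2 L2, link x L1 /\ link y L2 /\
    leq P (plug C (LPar (plug (spine l1) L1) (plug (spine l2) L2))).

Definition nested (x y : nat * lit) (P : linking) : Prop :=
  exists X, link x X /\ In y (lleaves X) /\ reaches P X.

Lemma joined_plug x y P P' C : leq P' (plug C P) -> joined x y P -> joined x y P'.
Proof.
  intros H (D & l1 & L1 & l2 & L2 & H1 & H2 & H3).
  exists (ccomp C D), l1, L1, l2, L2. repeat split; auto.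
  rewrite plug_ccomp. eapply rst_trans; [exact H | now apply leq_plug].
Qed.

(** Descend while both leaves lie in the same premise. As [y] is no ⊥, the descent stops at a ⅋
    separating them, at an axiom containing both, or at the ⊥ [x] tensored to a premise containing
    [y]; so an overlap always shows in the link of [x]. *)
Lemma joined_or_nested x y P :
  In x (lleaves P) -> In y (lleaves P) -> snd x <> One -> snd y <> Bot ->
  joined x y P \/ nested x y P.
Proof.
  intros Hx Hy Nx Ny.
  induction P as [j | a j k | a j k | k P IH | P IH k | P IHP Q IHQ]; simpl in Hx, Hy.
  - destruct Hx as [<- | []]. now simpl in Nx.
  - right. exists (LAxNP a k j). split; [| split].
    + destruct Hx as [<- | [<- | []]]; auto.
    + simpl. tauto.
    + apply reaches_refl, leq_ax_comm.
  - right. exists (LAxNP a j k). split; [| split].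
    + destruct Hx as [<- | [<- | []]]; auto.
    + simpl. tauto.
    + apply reaches_refl, leq_refl.
  - destruct Hy as [<- | Hy]; [now simpl in Ny |]. destruct Hx as [<- | Hx].
    + right. exists (LBotR P k). repeat split; auto.
      * apply in_or_app. now left.
      * apply reaches_refl, leq_bot_comm.
    + destruct (IH Hx Hy) as [J | (X & H1 & H2 & H3)].
      * left. revert J. apply joined_plug with (CBotL k Hole), leq_refl.
      * right. exists X. auto.
  - apply in_app_or in Hx, Hy. destruct Hy as [Hy | [<- | []]]; [| now simpl in Ny].
    destruct Hx as [Hx | [<- | []]].
    + destruct (IH Hx Hy) as [J | (X & H1 & H2 & H3)].
      * left. revert J. apply joined_plug with (CBotR Hole k), leq_refl.
      * right. exists X. auto.
    + right. exists (LBotR P k). repeat split; auto.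
      * apply in_or_app. now left.
      * apply reaches_refl, leq_refl.
  - apply in_app_or in Hx, Hy. destruct Hx as [Hx | Hx], Hy as [Hy | Hy].
    + destruct (IHP Hx Hy) as [J | (X & H1 & H2 & H3)].
      * left. revert J. apply joined_plug with (CParL Hole Q), leq_refl.
      * right. exists X. auto.
    + apply link_reached in Hx as (L1 & K1 & [l1 M1]), Hy as (L2 & K2 & [l2 M2]).
      left. exists Hole, l1, L1, l2, L2. repeat split; auto. simpl.
      eapply rst_trans; [apply (leq_plug (CParL Hole Q)), M1 | apply (leq_plug (CParR _ Hole)), M2].
    + apply link_reached in Hx as (L1 & K1 & [l1 M1]), Hy as (L2 & K2 & [l2 M2]).
      left. exists Hole, l1, L1, l2, L2. repeat split; auto. simpl.
      eapply rst_trans; [apply leq_par_comm |].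
      eapply rst_trans; [apply (leq_plug (CParL Hole P)), M1 | apply (leq_plug (CParR _ Hole)), M2].
    + destruct (IHQ Hx Hy) as [J | (X & H1 & H2 & H3)].
      * left. revert J. apply joined_plug with (CParR P Hole), leq_refl.
      * right. exists X. auto.
Qed.

Definition anchored (i : nat) (P : linking) : Prop :=
  forall r E, lout P r E -> conn E i r.

Lemma link_anchored x X : link x X -> anchored (fst x) X.
Proof.
  destruct 1 as [a h i | a j k | Q i | j]; intros r E H; simpl.
  - apply lout_axNP in H as [[-> ->] | [-> ->]]; auto. apply conn_sym, conn_edge. now left.
  - apply lout_axNP in H as [[-> ->] | [-> ->]]; auto. apply conn_sym, conn_edge. now left.
  - apply lout_botR in H as (E' & _ & ->). apply conn_sym, conn_edge. now left.
  - apply lout_one in H as [-> _]. auto.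
Qed.

(** A ⊥ on the path keeps the representative and only adds an edge. A ⅋ could be switched to its
    side premise, which is why the path may contain nothing but ⊥s. *)
Lemma anchored_bots i P ks : anchored i P -> anchored i (plug (spine (map inr ks)) P).
Proof.
  intros HP. induction ks as [| k ks IH]; simpl; auto.
  intros r E H. apply lout_botR in H as (E' & H & ->). apply IH in H. revert H.
  apply conn_mono. intros e He. now right.
Qed.

(** [X] can be switched so that its representative is connected to [y], and [x] is connected to it
    in any case. The cut edge then closes a cycle inside [X]. *)
Lemma nested_absurd x y C X G :
  acorrect (plug C X) G -> (forall F, seq_outcome G F -> In (fst x, fst y) F) ->
  link x X -> In y (lleaves X) -> False.
Proof.
  rewrite acorrect_plug. intros HA HG Hx Hy. destruct (lout_exists X) as (r0 & E0 & H0).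
  destruct (lout_reach X r0 E0 [] (fst y) (fst y)) as (r & E & H & HC); auto.
  { unfold leaf_of. now apply in_map. }
  rewrite app_nil_r in HC. assert (HX := link_anchored _ _ Hx _ _ H).
  destruct (env_exists C G) as (ks & Z & HZ).
  destruct (HA _ _ _ _ H HZ) as [HF _]. destruct HZ as (up & F0 & F & HCx & HGF & ->).
  apply HG, in_split in HGF as (F1 & F2 & ->).
  assert (HP : Permutation (E ++ star r ks ++ F0 ++ F1 ++ (fst x, fst y) :: F2)
                 ((fst x, fst y) :: E ++ star r ks ++ F0 ++ F1 ++ F2))
    by (rewrite !app_assoc; symmetry; apply Permutation_middle).
  apply (forest_perm _ _ HP) in HF. destruct HF as [HF _]. apply HF. simpl.
  apply conn_mono with E; [apply incl_appl, incl_refl |].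
  eapply conn_trans; [exact HX | now apply conn_sym].
Qed.

Lemma bot_out_separated C A B i j k G :
  acorrect (plug C (LPar B (LBotR A k))) G -> anchored i A -> anchored j B ->
  (forall F, seq_outcome G F -> conn F i j) ->
  forall r E ks Z q, lout (LPar B A) r E -> env C G ks Z -> leaf_of B q ->
    ~ conn (E ++ star r ks ++ Z) k q.
Proof.
  intros HA HiA HjB HG r E ks Z q HX HZ Hq HC. rewrite acorrect_plug in HA.
  assert (HZij : conn Z i j).
  { destruct HZ as (up & F0 & F & _ & HF & ->). apply HG in HF. revert HF.
    apply conn_mono, incl_appr, incl_refl. }
  assert (H0 : forall rB EB rA EA x, lout B rB EB -> lout A rA EA -> x = rB \/ x = rA ->
     ~ conn ((EB ++ EA) ++ star x ks ++ Z) k rA).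
  { intros rB EB rA EA x HB HA' Hx HC'.
    assert (HL : lout (LPar B (LBotR A k)) x (EB ++ (rA, k) :: EA)).
    { apply lout_par. exists rB, EB, rA, ((rA, k) :: EA). repeat split; auto. apply lout_botR. eauto. }
    destruct (HA _ _ _ _ HL HZ) as [HF _].
    assert (HP : Permutation ((EB ++ (rA, k) :: EA) ++ star x ks ++ Z)
                   ((rA, k) :: (EB ++ EA) ++ star x ks ++ Z))
      by (rewrite <- !app_assoc; symmetry; apply Permutation_middle).
    apply (forest_perm _ _ HP) in HF. destruct HF as [HF _]. now apply HF, conn_sym. }
  (* The chain is [rB], [j], [i], [rA]: anchoring in [B], the cut, anchoring in [A]. It uses neither
     the edge of ⊥_k nor the star. *)
  assert (H1 : forall rB EB rA EA x, lout B rB EB -> lout A rA EA ->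
     conn ((EB ++ EA) ++ star x ks ++ Z) rB rA).
  { intros rB EB rA EA x HB HA'. apply HjB in HB. apply HiA in HA'.
    apply conn_trans with j; [| apply conn_trans with i].
    - apply conn_sym. revert HB. apply conn_mono. now apply incl_appl, incl_appl.
    - apply conn_sym. revert HZij. apply conn_mono. now apply incl_appr, incl_appr.
    - revert HA'. apply conn_mono. now apply incl_appl, incl_appr. }
  apply lout_par in HX as (rB & EB & rA & EA & HB & HA' & Hr & ->).
  assert (HC' : conn (star r ks ++ ((EB ++ EA) ++ Z)) k q).
  { revert HC. apply conn_perm. rewrite !app_assoc. apply Permutation_app_tail.
    rewrite <- (app_assoc (star r ks)). apply Permutation_app_comm. }
  (* A path meeting the star reaches [r], one of the two roots. Any other path survives when [B] is
     switched towards [q] and the common ⅋ towards [B]. Both ways ⊥_k is connected to [rA] without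
     its own edge. *)
  apply conn_star in HC' as [HC' | HC'].
  - apply (H0 _ _ _ _ _ HB HA' Hr). apply conn_trans with r.
    + revert HC'. apply conn_perm. rewrite !app_assoc. apply Permutation_app_tail.
      rewrite <- (app_assoc (star r ks)). apply Permutation_app_comm.
    + destruct Hr as [-> | ->]; auto.
  - rewrite <- app_assoc in HC'.
    destruct (lout_reach _ _ _ _ _ _ HB Hq HC') as (rB' & EB' & HB' & HC'').
    apply (H0 _ _ _ _ _ HB' HA' (or_introl eq_refl)).
    apply conn_trans with rB'; [| apply H1; auto]. revert HC''. rewrite <- app_assoc.
    apply conn_incl_app; auto using incl_refl. apply incl_app_app; auto using incl_refl, incl_appr.
Qed.

Lemma leq_sim_ctx C P P' G :
  leq P P' -> proof_graph (plug C P, G) ->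
  proof_graph (plug C P', G) /\ sim (plug C P, G) (plug C P', G).
Proof.
  intros H HP. destruct (leq_sim _ _ G (leq_plug C _ _ H)). tauto.
Qed.

(** Besides a path of ⊥s only, the first ⅋ sits either at the very node or directly on a ⊥; each
    shape admits one kind of step. *)
Lemma spine_cases (l : list (linking + nat)) :
  (exists ks, l = map inr ks)
  \/ (exists R l', l = inl R :: l')
  \/ (exists ks k R l', l = map inr ks ++ inr k :: inl R :: l').
Proof.
  induction l as [| [R | k] l IH]; [left; now exists [] | right; left; eauto |].
  destruct IH as [(ks & ->) | [(R & l' & ->) | (ks & k' & R & l' & ->)]].
  - left. now exists (k :: ks).
  - right; right. now exists [], k, R, l'.
  - right; right. now exists (k :: ks), k', R, l'.
Qed.

(** The path to [L1] loses one element. A ⅋ next to the node goes into the context by associativity;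
    a ⊥ just below the first ⅋ is absorbed into its side premise; on a path of ⊥s the lowest one is
    moved below the node. Only the last case needs both links to be anchored at the node, hence the
    condition on [l2]. *)
Lemma spine_step C x l1 l2 L1 L2 i j G :
  anchored i L1 -> anchored j L2 -> (forall F, seq_outcome G F -> conn F i j) ->
  (exists ks, l2 = map inr ks) \/ ~ (exists ks, x :: l1 = map inr ks) ->
  proof_graph (plug C (LPar (plug (spine (x :: l1)) L1) (plug (spine l2) L2)), G) ->
  exists C' l1', length l1' = length l1
    /\ proof_graph (plug C' (LPar (plug (spine l1') L1) (plug (spine l2) L2)), G)
    /\ sim (plug C (LPar (plug (spine (x :: l1)) L1) (plug (spine l2) L2)), G)
           (plug C' (LPar (plug (spine l1') L1) (plug (spine l2) L2)), G).
Proof.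
  intros A1 A2 HG HB HP.
  destruct (spine_cases (x :: l1)) as [(ks & Hks) | [(R & l' & Hl) | (ks & k & R & l' & Hl)]].
  - destruct HB as [(ms & ->) | HB]; [| exfalso; eauto].
    destruct ks as [| k ks]; [discriminate |]. injection Hks as -> ->.
    exists (ccomp C (CBotR Hole k)), (map inr ks). split; auto.
    rewrite plug_ccomp. simpl in *.
    set (A := plug (spine (map inr ks)) L1) in *. set (B := plug (spine (map inr ms)) L2) in *.
    destruct (leq_sim_ctx C _ _ G (leq_par_comm (LBotR A k) B) HP) as [P1 S1].
    destruct (par_bot_down C B A k G P1) as [P2 S2].
    { apply bot_out_separated with i j; auto.
      - now apply proof_graph_acorrect in P1.
      - now apply anchored_bots.
      - now apply anchored_bots. }
    destruct (leq_sim_ctx C _ _ G (leq_plug (CBotR Hole k) _ _ (leq_par_comm B A)) P2) as [P3 S3].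
    split; [exact P3 |]. eapply rst_trans; [exact S1 |]. eapply rst_trans; [exact S2 | exact S3].
  - injection Hl as -> ->.
    exists (ccomp C (CParR R Hole)), l'. split; auto. rewrite plug_ccomp. simpl in *.
    apply leq_sim_ctx; auto. apply rst_sym, leq_par_assoc.
  - set (B := plug (spine l2) L2) in *.
    exists C, (map inr ks ++ inl (LBotR R k) :: l'). split.
    { apply (f_equal (@length _)) in Hl. simpl in Hl. rewrite length_app in *. simpl in *. lia. }
    rewrite Hl in *. rewrite !spine_app, !plug_ccomp in *. simpl in *.
    set (A := plug (spine l') L1) in *. set (K := spine (map inr ks)) in *.
    assert (HK : forall X, plug C (LPar (plug K X) B) = plug (ccomp (ccomp C (CParL Hole B)) K) X)
      by (intros; now rewrite !plug_ccomp).
    rewrite (HK (LBotR (LPar R A) k)) in *. rewrite (HK (LPar (LBotR R k) A)) in *.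
    set (D := ccomp (ccomp C (CParL Hole B)) K) in *.
    destruct (leq_sim_ctx D _ _ G (leq_plug (CBotR Hole k) _ _ (leq_par_comm R A)) HP) as [P1 S1].
    destruct (par_bot_up D A R k G P1) as [P2 S2].
    destruct (leq_sim_ctx D _ _ G (leq_par_comm A (LBotR R k)) P2) as [P3 S3].
    split; [exact P3 |]. eapply rst_trans; [exact S1 |]. eapply rst_trans; [exact S2 | exact S3].
Qed.

(** Induction on the total length. If [l1] contains a ⅋ it can be shortened, whatever [l2] is. If it
    consists of ⊥s, then [l2] can be shortened after commuting the node; and once [l2] is empty, it
    counts as a path of ⊥s and [l1] can be shortened. *)
Lemma spine_unite l1 l2 C L1 L2 i j G :
  anchored i L1 -> anchored j L2 -> (forall F, seq_outcome G F -> conn F i j) ->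
  proof_graph (plug C (LPar (plug (spine l1) L1) (plug (spine l2) L2)), G) ->
  exists C', proof_graph (plug C' (LPar L1 L2), G)
    /\ sim (plug C (LPar (plug (spine l1) L1) (plug (spine l2) L2)), G) (plug C' (LPar L1 L2), G).
Proof.
  intros A1 A2 HG. remember (length l1 + length l2) as n eqn:Hn.
  revert l1 l2 C Hn. induction n as [n IH] using (well_founded_induction Wf_nat.lt_wf).
  intros l1 l2 C -> HP.
  assert (HB : (exists ks, l1 = map inr ks) \/ ~ (exists ks, l1 = map inr ks)).
  { destruct (spine_cases l1) as [H | [(R & l & ->) | (ks & k & R & l & ->)]]; auto; right;
      intros [ms Hms]; (assert (X : In (inl R) (map inr ms))
        by (rewrite <- Hms, ?in_app_iff; simpl; auto));
      apply in_map_iff in X as (? & ? & _); discriminate. }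
  assert (Left : forall x l, l1 = x :: l -> (exists ks, l2 = map inr ks) \/ ~ (exists ks, l1 = map inr ks) ->
    exists C', proof_graph (plug C' (LPar L1 L2), G)
    /\ sim (plug C (LPar (plug (spine l1) L1) (plug (spine l2) L2)), G) (plug C' (LPar L1 L2), G)).
  { intros x l -> HB'.
    destruct (spine_step C x l l2 L1 L2 i j G) as (C' & l' & Hl & P1 & S1); auto.
    destruct (IH (length l' + length l2)) with (l1 := l') (l2 := l2) (C := C') as (C'' & P2 & S2); auto.
    { simpl. lia. }
    exists C''. split; auto. eapply rst_trans; eauto. }
  destruct HB as [HB | HB].
  - destruct l2 as [| x l2].
    + destruct l1 as [| x l1]; [| apply (Left x l1); auto; left; now exists []].
      exists C. split; [exact HP | apply rst_refl].
    + destruct (leq_sim_ctx C _ _ G (leq_par_comm _ _) HP) as [P0 S0].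
      destruct (spine_step C x l2 l1 L2 L1 j i G) as (C' & l' & Hl & P1 & S1); auto.
      { intros F HF. now apply conn_sym, HG. }
      destruct (leq_sim_ctx C' _ _ G (leq_par_comm _ _) P1) as [P2 S2].
      destruct (IH (length l1 + length l')) with (l1 := l1) (l2 := l') (C := C') as (C'' & P3 & S3); auto.
      { simpl. lia. }
      exists C''. split; auto. eapply rst_trans; [exact S0 |]. eapply rst_trans; [exact S1 |].
      eapply rst_trans; [exact S2 | exact S3].
  - destruct l1 as [| x l1]; [exfalso; apply HB; now exists [] | eapply Left; eauto].
Qed.

Lemma cut_leaves_unite x y P G :
  proof_graph (P, G) -> In x (lleaves P) -> In y (lleaves P) -> snd x <> One -> snd y <> Bot ->
  (forall F, seq_outcome G F -> In (fst x, fst y) F) ->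
  exists C L1 L2, link x L1 /\ link y L2 /\
    proof_graph (plug C (LPar L1 L2), G) /\ sim (P, G) (plug C (LPar L1 L2), G).
Proof.
  intros HP Hx Hy Nx Ny HG.
  destruct (joined_or_nested x y P Hx Hy Nx Ny) as
    [(C & l1 & L1 & l2 & L2 & H1 & H2 & HL) | (X & H1 & H2 & [l HL])].
  - destruct (leq_sim _ _ G HL) as [K1 K2]. apply K1 in HP as P1.
    destruct (spine_unite l1 l2 C L1 L2 (fst x) (fst y) G) as (C' & P2 & S2); auto using link_anchored.
    exists C', L1, L2. split; [| split; [| split]]; auto.
    eapply rst_trans; [apply K2, HP | exact S2].
  - destruct (leq_sim _ _ G HL) as [K1 K2]. apply K1 in HP as P1. exfalso.
    apply proof_graph_acorrect in P1 as (_ & _ & _ & P1). exact (nested_absurd x y _ X G P1 HG H1 H2).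
Qed.

(** * Cuts in sequents *)

Lemma seq_outcome_perm G G' F :
  Permutation G G' -> seq_outcome G F -> exists F', seq_outcome G' F' /\ Permutation F F'.
Proof.
  intros HP. revert F. induction HP as [| e G G' _ IH | e1 e2 G | G1 G2 G3 _ IH1 _ IH2]; intros F H.
  - eauto.
  - inversion H as [| ? ? r E F' H1 H2]; subst. apply IH in H2 as (F'' & H3 & H4).
    exists (E ++ F''). split; [econstructor; eauto | now apply Permutation_app_head].
  - inversion H as [| ? ? r E F' H1 H2]; subst. inversion H2 as [| ? ? r' E' F'' H3 H4]; subst.
    exists (E' ++ E ++ F''). split.
    + econstructor; [eauto |]. econstructor; eauto.
    + rewrite !app_assoc. apply Permutation_app_tail, Permutation_app_comm.
  - apply IH1 in H as (F' & H1 & H2). apply IH2 in H1 as (F'' & H3 & H4).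
    exists F''. split; auto. now rewrite H2.
Qed.

Lemma proof_graph_seq_perm P G G' :
  Permutation G G' -> proof_graph (P, G) -> proof_graph (P, G').
Proof.
  intros HP. rewrite !proof_graph_acorrect. intros (H1 & H2 & H3 & H4). split; [| split; [| split]]; auto.
  - rewrite H1. unfold sleaves. now apply Permutation_flat_map.
  - intros A B H. apply H3. now apply (Permutation_in _ (Permutation_sym HP)).
  - intros r E F HE HF. apply (seq_outcome_perm _ G) in HF as (F' & HF & HQ); [| now symmetry].
    apply spans_perm with (E ++ F'); [now apply Permutation_app_head, Permutation_sym | eauto].
Qed.

Lemma entry_to_front P G1 e G2 :
  proof_graph (P, G1 ++ e :: G2) -> sim (P, G1 ++ e :: G2) (P, e :: G1 ++ G2).
Proof.
  revert G2. induction G1 as [| e' G1 IH] using rev_ind; intros G2 H; [apply rst_refl |].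
  rewrite <- !app_assoc in *. simpl in *.
  assert (H' : proof_graph (P, G1 ++ e :: e' :: G2))
    by (revert H; apply proof_graph_seq_perm, Permutation_app_head, perm_swap).
  eapply rst_trans; [| apply IH, H'].
  apply rst_step. split; [| split]; auto. constructor.
Qed.

Lemma dual_lit_sym l m : dual_lit l m -> dual_lit m l.
Proof. destruct l, m; simpl; auto. Qed.

Lemma is_dual_sym A B : is_dual A B -> is_dual B A.
Proof.
  revert B. induction A; intros []; simpl; try easy.
  - apply dual_lit_sym.
  - intros []. auto.
  - intros []. auto.
Qed.

Lemma cut_outcome A B r E :
  outcome (e2t (ECut A B)) r E <->
  exists rA EA rB EB, outcome (f2t A) rA EA /\ outcome (f2t B) rB EB
    /\ r = rA /\ E = (rA, rB) :: EA ++ EB.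
Proof.
  split.
  - intros H. inversion H as [| d b A' B' ra EA rb EB HA HB |]; subst. eauto 9.
  - intros (rA & EA & rB & EB & HA & HB & -> & ->). now apply (out_tens (fun _ => false) true).
Qed.

Lemma par_outcome A B r E :
  outcome (f2t (FPar A B)) r E <->
  exists rA EA rB EB, outcome (f2t A) rA EA /\ outcome (f2t B) rB EB
    /\ (r = rA \/ r = rB) /\ E = EA ++ EB.
Proof.
  split.
  - intros H. inversion H as [| | b A' B' ra EA rb EB HA HB]; subst.
    exists ra, EA, rb, EB. repeat split; auto. destruct b; auto.
  - intros (rA & EA & rB & EB & HA & HB & [-> | ->] & ->).
    + now apply (out_par false _ _ rA EA rB EB).
    + now apply (out_par true _ _ rA EA rB EB).
Qed.

Lemma cut_swap P A B G :
  proof_graph (P, ECut A B :: G) ->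
  proof_graph (P, ECut B A :: G) /\ sim (P, ECut A B :: G) (P, ECut B A :: G).
Proof.
  intros HP. assert (HP' : proof_graph (P, ECut B A :: G)).
  { revert HP. rewrite !proof_graph_acorrect. intros (H1 & H2 & H3 & H4). split; [| split; [| split]]; auto.
    - rewrite H1. unfold sleaves. simpl. apply Permutation_app_tail, Permutation_app_comm.
    - intros A' B' [H | H]; [injection H as <- <-; apply is_dual_sym, H3; now left | apply H3; now right].
    - intros r E F HE HF. inversion HF as [| ? ? r' E' F' HC HF']; subst.
      apply cut_outcome in HC as (rB & EB & rA & EA & HB & HA & -> & ->).
      assert (HS : spans (leaf_of P) (E ++ ((rA, rB) :: EA ++ EB) ++ F')).
      { eapply H4; eauto. econstructor; eauto. apply cut_outcome. eauto 9. }
      apply spans_perm with ((rB, rA) :: E ++ (EA ++ EB) ++ F').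
      { simpl. rewrite Permutation_middle. apply Permutation_app_head, perm_skip, Permutation_app_tail, Permutation_app_comm. }
      apply spans_flip. revert HS. apply spans_perm. symmetry. apply Permutation_middle. }
  split; auto. apply rst_step. split; [| split]; auto. apply (ss_cut_swap P []).
Qed.

(** * Reduction preserves correctness *)

Lemma lit_eq_dec (l m : lit) : {l = m} + {l <> m}.
Proof. decide equality; apply Nat.eq_dec. Defined.

Definition edge_eq_dec (x y : nat * nat) : {x = y} + {x <> y}.
Proof. decide equality; apply Nat.eq_dec. Defined.

Definition leaf_eq_dec (x y : nat * lit) : {x = y} + {x <> y}.
Proof. decide equality; [apply lit_eq_dec | apply Nat.eq_dec]. Defined.

(** Permutations of concatenations are settled by counting occurrences, with each cons split off as
    a singleton; what remains is linear arithmetic. *)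
Ltac solve_perm dec :=
  apply (Permutation_count_occ dec); let x := fresh in intros x;
  repeat match goal with
  | |- context [count_occ dec (?a :: ?l) x] =>
      lazymatch l with
      | [] => fail
      | _ => change (count_occ dec (a :: l) x) with (count_occ dec ([a] ++ l) x)
      end
  | |- context [count_occ dec (?l ++ ?m) x] => rewrite (count_occ_app dec l m x)
  end; lia.

(** For removing the two leaves of a cut: [f] sends them to surviving leaves and fixes the others,
    so connections carry over. Acyclicity is supplied separately, since collapsing vertices could
    create cycles. *)
Lemma spans_retract {V} (f : V -> V) (L L' : V -> Prop) E Z :
  spans L' E -> forest Z ->
  (forall u v, In (u, v) E -> conn Z (f u) (f v)) ->
  (forall u, L u -> L' u /\ f u = u) ->
  spans L Z.
Proof.
  intros [_ HC] HF HE HL. split; auto. intros u v Hu Hv.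
  apply HL in Hu as [Hu Fu], Hv as [Hv Fv]. rewrite <- Fu, <- Fv.
  apply (conn_map f E); auto.
Qed.

(* Without the two cut edges there are three components, and a and b are in
   the same one since both are separated from a' and b'. *)
Lemma spans_mult {V} (L : V -> Prop) a b a' b' Z :
  L a -> L b ->
  spans L ((a, b') :: (b', a') :: Z) -> spans L ((b, b') :: (b', a') :: Z) ->
  spans L ((a, a') :: (b, b') :: Z).
Proof.
  intros La Lb [[F1 [F2 F3]] C1] [[F4 _] _]. simpl in *.
  assert (Hab : conn Z a b).
  { assert (C := C1 a b La Lb). apply conn_cons in C as [C | [[_ C] | [C _]]];
      [| destruct F4; now apply conn_sym | contradiction].
    apply conn_cons in C as [C | [[C _] | [_ C]]]; [exact C | destruct F1 | destruct F4];
      rewrite conn_cons; auto using conn_sym. }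
  rewrite conn_cons in F1, F4.
  assert (F5 : ~ conn ((b, b') :: Z) a a').
  { rewrite conn_cons. intros [H | [[_ H] | [H _]]]; [| tauto |].
    - apply F1. right. right. split; auto.
    - apply F1. auto. }
  assert (F6 : ~ conn Z b b') by (intros H; apply F4; auto).
  split; [simpl; auto |].
  intros x y Lx Ly. generalize (C1 x y Lx Ly). apply (conn_map (fun v => v)).
  assert (M : forall u v, conn Z u v -> conn ((a, a') :: (b, b') :: Z) u v)
    by (intros u v; apply conn_mono; intros z Hz; simpl; auto).
  assert (Ea : conn ((a, a') :: (b, b') :: Z) a a') by (apply conn_edge; simpl; auto).
  assert (Eb : conn ((a, a') :: (b, b') :: Z) b b') by (apply conn_edge; simpl; auto).
  assert (E1 : conn ((a, a') :: (b, b') :: Z) a b') by (apply conn_trans with b; auto).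
  intros u v [H | [H | H]].
  - injection H as <- <-. exact E1.
  - injection H as <- <-. apply conn_trans with a; auto using conn_sym.
  - auto.
Qed.

Lemma mult_correct P A B A' B' G :
  proof_graph (P, ECut (FPar A B) (FTens B' A') :: G) ->
  proof_graph (P, ECut A A' :: ECut B B' :: G).
Proof.
  rewrite !proof_graph_acorrect. intros (H1 & H2 & H3 & H4). split; [| split; [| split]]; auto.
  - rewrite H1. unfold sleaves. simpl. solve_perm leaf_eq_dec.
  - destruct (H3 _ _ (or_introl eq_refl)) as [D1 D2].
    intros A0 B0 [H | [H | H]]; [injection H as <- <- | injection H as <- <- |]; auto.
    apply H3. now right.
  - intros r E F HE HF. inversion HF as [| ? ? r1 E1 F1 HC1 HF1]; subst.
    inversion HF1 as [| ? ? r2 E2 F2 HC2 HF2]; subst.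
    apply cut_outcome in HC1 as (rA & EA & rA' & EA' & HA & HA' & _ & ->).
    apply cut_outcome in HC2 as (rB & EB & rB' & EB' & HB & HB' & _ & ->).
    set (Z := E ++ EA ++ EB ++ EB' ++ EA' ++ F2).
    (* The ⅋ of the cut formula is switched both ways with all other choices fixed, giving two
       spanning trees over the same [Z]. *)
    assert (K : forall x, x = rA \/ x = rB -> spans (leaf_of P) ((x, rB') :: (rB', rA') :: Z)).
    { intros x Hx. apply spans_perm with
        (E ++ ((x, rB') :: (EA ++ EB) ++ ((rB', rA') :: EB' ++ EA')) ++ F2).
      { unfold Z. solve_perm edge_eq_dec. }
      eapply H4; eauto. econstructor; eauto. apply cut_outcome.
      exists x, (EA ++ EB), rB', ((rB', rA') :: EB' ++ EA'). split; [| split]; auto.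
      - apply par_outcome. exists rA, EA, rB, EB. auto.
      - now apply (out_tens (fun _ => false) true). }
    apply spans_perm with ((rA, rA') :: (rB, rB') :: Z).
    { unfold Z. solve_perm edge_eq_dec. }
    assert (LG : forall i, In i (map fst (fleaves A)) \/ In i (map fst (fleaves B)) -> leaf_of P i).
    { intros i Hi. unfold leaf_of. apply (Permutation_in i (Permutation_map fst (Permutation_sym H1))).
      unfold sleaves. simpl. rewrite !map_app, !in_app_iff. tauto. }
    apply outcome_ends in HA as [HA _], HB as [HB _]. rewrite tleaves_f2t in HA, HB.
    apply spans_mult; auto.
Qed.

Lemma cut_leaf_outcome i l j m G F :
  seq_outcome (ECut (FLeaf i l) (FLeaf j m) :: G) F <->
  exists F', seq_outcome G F' /\ F = (i, j) :: F'.
Proof.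
  split.
  - intros H. inversion H as [| ? ? r1 E1 F1 HC1 HF1]; subst.
    apply cut_outcome in HC1 as (r1' & E1' & r2 & E2 & H1 & H2 & _ & ->).
    inversion H1; inversion H2; subst. eauto.
  - intros (F' & H & ->). apply (sout_cons (ECut (FLeaf i l) (FLeaf j m)) G i [(i, j)]); auto.
    apply cut_outcome. exists i, [], j, []. repeat split; constructor.
Qed.

Lemma env_cut C i l j m G ks Z :
  env C G ks Z ->
  exists Z', env C (ECut (FLeaf i l) (FLeaf j m) :: G) ks Z' /\ Permutation Z' ((i, j) :: Z).
Proof.
  intros (up & F0 & F & HC & HF & ->). exists (F0 ++ (i, j) :: F). split.
  - exists up, F0, ((i, j) :: F). repeat split; auto. apply cut_leaf_outcome. eauto.
  - symmetry. apply Permutation_middle.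
Qed.

Lemma env_ends C G ks Z :
  env C G ks Z ->
  (forall k, In k ks -> In k (map fst (cleaves C)))
  /\ forall e, In e Z ->
       (In (fst e) (map fst (cleaves C)) \/ In (fst e) (map fst (sleaves G)))
       /\ (In (snd e) (map fst (cleaves C)) \/ In (snd e) (map fst (sleaves G))).
Proof.
  intros (up & F0 & F & HC & HF & ->). apply ctx_outcome_ends in HC as (H1 & _ & H2). split; auto.
  intros e He. apply in_app_or in He as [He | He]; [apply H2 in He; tauto |].
  eapply seq_outcome_ends in HF; eauto. tauto.
Qed.

(** On leaves the path from [h] over [i] and [j] to [k], made of the two axioms and the cut, shrinks
    to a single edge. *)
Lemma ax_correct C a h i j k G :
  proof_graph (plug C (LPar (LAxNP a h i) (LAxNP a j k)),
               ECut (FLeaf i (Pos a)) (FLeaf j (Neg a)) :: G) ->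
  proof_graph (plug C (LAxNP a h k), G).
Proof.
  set (X := LPar (LAxNP a h i) (LAxNP a j k)).
  rewrite !proof_graph_acorrect. intros (H1 & H2 & H3 & H4).
  assert (HP : Permutation (lleaves (plug C X)) ((i, Pos a) :: (j, Neg a) :: lleaves (plug C (LAxNP a h k)))).
  { rewrite !lleaves_plug. simpl. solve_perm leaf_eq_dec. }
  assert (HG : Permutation (lleaves (plug C (LAxNP a h k))) (sleaves G)).
  { rewrite HP in H1. unfold sleaves in H1. simpl in H1. now apply Permutation_cons_inv, Permutation_cons_inv in H1. }
  assert (HN : NoDup (i :: j :: map fst (lleaves (plug C (LAxNP a h k))))).
  { revert H2. apply Permutation_NoDup. apply (Permutation_map fst) in HP. exact HP. }
  apply NoDup_cons_iff in HN as [Ni HN]. apply NoDup_cons_iff in HN as [Nj HN].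
  assert (Lf : forall u, leaf_of (plug C (LAxNP a h k)) u -> u <> i /\ u <> j).
  { intros u Hu. split; intros ->; [apply Ni; now right | now apply Nj]. }
  split; [| split; [| split]]; auto.
  { intros A B H. apply H3. now right. }
  apply acorrect_plug. intros r E ks Z HE HZ.
  assert (HrE : (r = h \/ r = k) /\ forall Y, spans (leaf_of (plug C (LAxNP a h k))) ((h, k) :: Y) ->
     spans (leaf_of (plug C (LAxNP a h k))) (E ++ Y)).
  { apply lout_axNP in HE as [[-> ->] | [-> ->]]; split; auto. intros Y. apply spans_flip. }
  destruct HrE as [Hr HrE]. apply HrE.
  destruct (env_cut C i (Pos a) j (Neg a) G ks Z HZ) as (Z' & HZ' & HPZ).
  (* For either end [r] of the new axiom the redex has an outcome with the same representative, so
     the star of the context stays as it is. *)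
  assert (HX : exists E', lout X r E' /\ (forall u v, In (u, v) E' ->
       (u = h /\ v = i) \/ (u = j /\ v = k) \/ (u = k /\ v = j))
       /\ In (h, i) E' /\ exists e, Permutation E' [(h, i); e] /\ (e = (j, k) \/ e = (k, j))).
  { destruct Hr as [-> | ->].
    - exists [(h, i); (j, k)]. split; [| split; [| split]]; simpl; auto.
      + apply lout_par. exists h, [(h, i)], j, [(j, k)].
        split; [| split; [| split]]; auto; apply lout_axNP; auto.
      + intros u v [H | [H | []]]; injection H as <- <-; auto.
      + exists (j, k). auto.
    - exists [(h, i); (k, j)]. split; [| split; [| split]]; simpl; auto.
      + apply lout_par. exists h, [(h, i)], k, [(k, j)].
        split; [| split; [| split]]; auto; apply lout_axNP; auto.
      + intros u v [H | [H | []]]; injection H as <- <-; auto.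
      + exists (k, j). auto. }
  destruct HX as (E' & HX & HE' & Hhi & e & HPe & He).
  assert (HS := proj1 (acorrect_plug _ _ _) H4 _ _ _ _ HX HZ').
  assert (Lhk : leaf_of (plug C (LAxNP a h k)) h /\ leaf_of (plug C (LAxNP a h k)) k)
    by (split; apply leaf_of_plug; left; unfold leaf_of; simpl; auto).
  destruct Lhk as [Lh Lk].
  assert (LY : forall x, In x (star r ks ++ Z) ->
     leaf_of (plug C (LAxNP a h k)) (fst x) /\ leaf_of (plug C (LAxNP a h k)) (snd x)).
  { assert (LG : forall u, In u (map fst (cleaves C)) \/ In u (map fst (sleaves G)) ->
       leaf_of (plug C (LAxNP a h k)) u).
    { intros u [Hu | Hu]; [apply leaf_of_plug; auto |].
      apply (Permutation_in u (Permutation_map fst (Permutation_sym HG))), Hu. }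
    apply env_ends in HZ as [K1 K2].
    intros x Hx. apply in_app_or in Hx as [Hx | Hx].
    - apply in_map_iff in Hx as (n & <- & Hn). simpl. split; [destruct Hr as [-> | ->]; auto | auto].
    - apply K2 in Hx as [Hx1 Hx2]. auto. }
  assert (HS' : spans (leaf_of (plug C X)) ((h, i) :: e :: (i, j) :: star r ks ++ Z)).
  { revert HS. apply spans_perm. rewrite HPe, HPZ. solve_perm edge_eq_dec. }
  (* Sending [i] to [h] and [j] to [k] makes both old axioms trivial and turns the cut into the new
     axiom. *)
  apply (spans_retract (fun u => if Nat.eq_dec u i then h else if Nat.eq_dec u j then k else u) _ _ _ _ HS').
  - destruct HS' as [(F1 & F2 & F3 & F4) _]. simpl in *. split; auto. intros HC. apply F1.
    assert (M : forall u v, conn (star r ks ++ Z) u v -> conn (e :: (i, j) :: star r ks ++ Z) u v)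
      by (intros u v; apply conn_mono; intros z Hz; simpl; auto).
    apply conn_trans with k; auto. apply conn_trans with j.
    + destruct He as [-> | ->]; [apply conn_sym |]; apply conn_edge; simpl; auto.
    + apply conn_sym, conn_edge. simpl. auto.
  - destruct (Lf _ Lh) as [Nh1 Nh2], (Lf _ Lk) as [Nk1 Nk2].
    assert (Nij : i <> j) by (intros <-; apply Ni; now left).
    intros u v [H | [H | [H | H]]].
    + injection H as <- <-.
      destruct (Nat.eq_dec h i), (Nat.eq_dec h j), (Nat.eq_dec i i); try contradiction; auto.
    + destruct He as [-> | ->]; injection H as <- <-;
        destruct (Nat.eq_dec j i), (Nat.eq_dec j j), (Nat.eq_dec k i), (Nat.eq_dec k j);
        try congruence; auto.
    + injection H as <- <-.
      destruct (Nat.eq_dec i i), (Nat.eq_dec j i), (Nat.eq_dec j j); try congruence.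
      apply conn_edge. now left.
    + destruct (LY _ H) as [L1 L2]. simpl in *. apply Lf in L1, L2.
      destruct (Nat.eq_dec u i), (Nat.eq_dec u j), (Nat.eq_dec v i), (Nat.eq_dec v j); try tauto.
      apply conn_edge. now right.
  - intros u Hu. split.
    + apply (Permutation_in u (Permutation_map fst (Permutation_sym HP))). simpl. right. now right.
    + apply Lf in Hu. destruct (Nat.eq_dec u i), (Nat.eq_dec u j); tauto.
Qed.

(** With the ⅋ switched to [Q], ⊥_i hangs at the representative [r] and 1_j hangs at ⊥_i through the
    cut. The reduction prunes this pendant path, which retracts to [r]. *)
Lemma unit_correct C Q i j G :
  proof_graph (plug C (LPar (LBotR Q i) (LOne j)), ECut (FLeaf i Bot) (FLeaf j One) :: G) ->
  proof_graph (plug C Q, G).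
Proof.
  set (X := LPar (LBotR Q i) (LOne j)).
  rewrite !proof_graph_acorrect. intros (H1 & H2 & H3 & H4).
  assert (HP : Permutation (lleaves (plug C X)) ((i, Bot) :: (j, One) :: lleaves (plug C Q))).
  { rewrite !lleaves_plug. simpl. solve_perm leaf_eq_dec. }
  assert (HG : Permutation (lleaves (plug C Q)) (sleaves G)).
  { rewrite HP in H1. unfold sleaves in H1. simpl in H1. now apply Permutation_cons_inv, Permutation_cons_inv in H1. }
  assert (HN : NoDup (i :: j :: map fst (lleaves (plug C Q)))).
  { revert H2. apply Permutation_NoDup. apply (Permutation_map fst) in HP. exact HP. }
  apply NoDup_cons_iff in HN as [Ni HN]. apply NoDup_cons_iff in HN as [Nj HN].
  assert (Lf : forall u, leaf_of (plug C Q) u -> u <> i /\ u <> j).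
  { intros u Hu. split; intros ->; [apply Ni; now right | now apply Nj]. }
  split; [| split; [| split]]; auto.
  { intros A B H. apply H3. now right. }
  apply acorrect_plug. intros r E ks Z HE HZ.
  destruct (env_cut C i Bot j One G ks Z HZ) as (Z' & HZ' & HPZ).
  assert (HX : lout X r (((r, i) :: E) ++ [])).
  { apply lout_par. exists r, ((r, i) :: E), j, []. split; [| split; [| split]]; auto.
    - apply lout_botR. eauto.
    - now apply lout_one. }
  assert (HS := proj1 (acorrect_plug _ _ _) H4 _ _ _ _ HX HZ').
  assert (LG : forall u, leaf_of Q u \/ In u (map fst (cleaves C)) \/ In u (map fst (sleaves G)) ->
       leaf_of (plug C Q) u).
  { intros u [Hu | [Hu | Hu]]; [apply leaf_of_plug; auto | apply leaf_of_plug; auto |].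
    apply (Permutation_in u (Permutation_map fst (Permutation_sym HG))), Hu. }
  assert (LY : forall x, In x (E ++ star r ks ++ Z) -> leaf_of (plug C Q) (fst x) /\ leaf_of (plug C Q) (snd x)).
  { apply env_ends in HZ as [K1 K2]. apply lout_ends in HE as [K3 K4].
    intros x Hx. apply in_app_or in Hx as [Hx | Hx]; [apply K4 in Hx; split; apply LG; tauto |].
    apply in_app_or in Hx as [Hx | Hx].
    - apply in_map_iff in Hx as (n & <- & Hn). simpl. split; auto.
    - apply K2 in Hx as [Hx1 Hx2]. auto. }
  assert (HS' : spans (leaf_of (plug C X)) ((r, i) :: (i, j) :: E ++ star r ks ++ Z)).
  { revert HS. apply spans_perm. rewrite HPZ, app_nil_r. solve_perm edge_eq_dec. }
  apply (spans_retract (fun u => if Nat.eq_dec u i then r else if Nat.eq_dec u j then r else u) _ _ _ _ HS').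
  - destruct HS' as [(_ & _ & F) _]. exact F.
  - apply lout_ends in HE as [Lr _]. destruct (Lf r) as [Nr1 Nr2]; auto.
    intros u v [H | [H | H]].
    + injection H as <- <-. destruct (Nat.eq_dec r i), (Nat.eq_dec r j), (Nat.eq_dec i i); try congruence; auto.
    + injection H as <- <-. destruct (Nat.eq_dec i i), (Nat.eq_dec j i), (Nat.eq_dec j j); try congruence; auto.
    + destruct (LY _ H) as [L1 L2]. simpl in *. apply Lf in L1, L2.
      destruct (Nat.eq_dec u i), (Nat.eq_dec u j), (Nat.eq_dec v i), (Nat.eq_dec v j); try tauto. auto.
  - intros u Hu. split.
    + apply (Permutation_in u (Permutation_map fst (Permutation_sym HP))). simpl. right. now right.
    + apply Lf in Hu. destruct (Nat.eq_dec u i), (Nat.eq_dec u j); tauto.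
Qed.

(** * Termination and normal forms *)

Fixpoint fsize (A : form) : nat :=
  match A with
  | FLeaf _ _ => 1
  | FTens A B | FPar A B => S (fsize A + fsize B)
  end.

Definition esize (e : entry) : nat :=
  match e with
  | EForm A => fsize A
  | ECut A B => S (fsize A + fsize B)
  end.

(** Cut nodes are counted too: a multiplicative step trades one ⊙, one ⅋ and one ⊗ for two ⊙, so the
    size drops by exactly one. *)
Definition gsize (X : pgraph) : nat := list_sum (map esize (snd X)).

Lemma simstep_size X Y : simstep X Y -> gsize X = gsize Y.
Proof.
  unfold gsize. destruct 1; simpl; auto; rewrite !map_app, !list_sum_app; simpl; lia.
Qed.

Lemma sim_size X Y : sim X Y -> gsize X = gsize Y.
Proof.
  induction 1 as [X Y (_ & _ & H) | | |]; try congruence. now apply simstep_size.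
Qed.

Lemma gred_size X Y : gred X Y -> gsize Y < gsize X.
Proof. unfold gsize. destruct 1; simpl; lia. Qed.

Lemma netred_size X Y : netred X Y -> gsize Y < gsize X.
Proof.
  intros (_ & _ & X' & Y' & HX & HY & H).
  rewrite (sim_size _ _ HX), (sim_size _ _ HY). now apply gred_size.
Qed.

Lemma netred_intro X X' Y :
  proof_graph X -> sim X X' -> gred X' Y -> proof_graph Y -> netred X Y.
Proof.
  intros. split; [| split]; auto. exists X', Y. split; [| split]; auto. apply rst_refl.
Qed.

Lemma leaf_cut_reduces P i l j m G :
  (exists a, l = Pos a /\ m = Neg a) \/ (l = Bot /\ m = One) ->
  proof_graph (P, ECut (FLeaf i l) (FLeaf j m) :: G) ->
  exists Y, netred (P, ECut (FLeaf i l) (FLeaf j m) :: G) Y.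
Proof.
  intros Hlm HP. assert (HL := HP). apply proof_graph_acorrect in HL as (HL & _).
  destruct (cut_leaves_unite (i, l) (j, m) P _ HP) as (C & L1 & L2 & K1 & K2 & HP' & HS).
  - apply (Permutation_in _ (Permutation_sym HL)). simpl. auto.
  - apply (Permutation_in _ (Permutation_sym HL)). simpl. auto.
  - destruct Hlm as [(a & -> & ->) | [-> ->]]; discriminate.
  - destruct Hlm as [(a & -> & ->) | [-> ->]]; discriminate.
  - intros F HF. apply cut_leaf_outcome in HF as (F' & _ & ->). now left.
  (* The shapes allowed by [link] are those of the redexes, so the united links can be reduced at
     once. *)
  - destruct Hlm as [(a & -> & ->) | [-> ->]].
    + inversion K1; inversion K2; subst. eexists.
      eapply netred_intro; [exact HP | exact HS | constructor |]. eapply ax_correct. exact HP'.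
    + inversion K1; inversion K2; subst. eexists.
      eapply netred_intro; [exact HP | exact HS | constructor |]. eapply unit_correct. exact HP'.
Qed.

Lemma netred_sim X X' Y : proof_graph X -> sim X X' -> netred X' Y -> netred X Y.
Proof.
  intros HX HS (_ & HY & X2 & Y2 & H1 & H2 & H3). split; [| split]; auto.
  exists X2, Y2. split; [| split]; auto. eapply rst_trans; eauto.
Qed.

Lemma cut_reduces P A B G :
  proof_graph (P, ECut A B :: G) -> exists Y, netred (P, ECut A B :: G) Y.
Proof.
  intros HP. assert (HD := HP). apply proof_graph_acorrect in HD as (_ & _ & HD & _).
  specialize (HD _ _ (or_introl eq_refl)).
  (* The reduction rules expect the ⅋, the positive atom or the ⊥ on the left of the cut; the
     opposite orientations are swapped. *)
  destruct (cut_swap _ _ _ _ HP) as [HP' HS].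
  destruct A as [i l | A1 A2 | A1 A2], B as [j m | B1 B2 | B1 B2]; simpl in HD; try contradiction.
  - destruct l as [a | a | |], m as [b | b | |]; simpl in HD; try contradiction; subst.
    + apply leaf_cut_reduces; eauto.
    + destruct (leaf_cut_reduces P j (Pos b) i (Neg b) G) as [Y HY]; eauto using netred_sim.
    + destruct (leaf_cut_reduces P j Bot i One G) as [Y HY]; eauto using netred_sim.
    + apply leaf_cut_reduces; auto.
  - eexists. eapply netred_intro; [exact HP | exact HS | constructor |]. now apply mult_correct.
  - eexists. eapply netred_intro; [exact HP | apply rst_refl | constructor |]. now apply mult_correct.
Qed.

Theorem theorem1p26 :
  (forall X : pgraph, proof_graph X -> Acc (fun Y X => netred X Y) X)
  /\ (forall X : pgraph, proof_graph X -> (forall Y, ~ netred X Y) -> cut_free X).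
Proof.
  split.
  - intros X _. induction X as [X IH] using (well_founded_induction (Wf_nat.well_founded_ltof _ gsize)).
    constructor. intros Y H. apply IH. now apply netred_size.
  - intros [P G] HP HN e He. simpl in He. destruct e as [A | A B]; [eauto |].
    exfalso. apply in_split in He as (G1 & G2 & ->).
    assert (HP' : proof_graph (P, ECut A B :: G1 ++ G2))
      by (revert HP; apply proof_graph_seq_perm; symmetry; apply Permutation_middle).
    destruct (cut_reduces _ _ _ _ HP') as [Y HY]. apply (HN Y).
    eapply netred_sim; [exact HP | now apply entry_to_front | exact HY].
Qed.
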